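(* Let $(\mathcal{X},\rho)$ be a Polish space (a separable complete metric space) and let $\{P_t\}_{t\in T}$ be a Markov-Feller semigroup on $\mathcal{X}$, where either $T=\mathbb{N}_+$, or $T=\mathbb{R}_+$ and $\{P_t\}_{t\in T}$ is strongly continuous on $C_b(\mathcal{X})$. Assume that $\{P_t\}_{t\in T}$ is eventually continuous (at every point of $\mathcal{X}$), let $\mu$ be an ergodic measure for $\{P_t\}_{t\in T}$, and put $\mathcal{X}_\mu:=\mathrm{supp}\,\mu$, regarded as a metric space with the restriction of $\rho$. Then $\{P_t\}_{t\in T}$, restricted to $\mathcal{X}_\mu$, has the e-property on $\mathcal{X}_\mu$; that is, for every $z\in\mathcal{X}_\mu$ and every $f\in L_b(\mathcal{X}_\mu)$, $$\limsup_{x\to z,\;x\in\mathcal{X}_\mu}\ \sup_{t\in T}|P_tf(x)-P_tf(z)|=0 .$$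
   Context: Notation: $\mathbb{R}_+=[0,\infty)$, $\mathbb{N}_+=\{1,2,\dots\}$; for a metric space $\mathcal{Y}$, $\mathcal{M}(\mathcal{Y})$ is the family of finite Borel measures and $\mathcal{P}(\mathcal{Y})$ the family of Borel probability measures on $\mathcal{Y}$; $B_b(\mathcal{Y})$, $C_b(\mathcal{Y})$, $L_b(\mathcal{Y})$ are the spaces of bounded Borel, bounded continuous, and bounded Lipschitz real-valued functions on $\mathcal{Y}$, respectively; $\|f\|_\infty$ is the supremum norm; $\langle f,\mu\rangle=\int f\,d\mu$; $B(x,r)$ is the open ball; $\mathrm{supp}\,\mu=\{x\in\mathcal{X}:\mu(B(x,\epsilon))>0\text{ for every }\epsilon>0\}$. A Markov operator is a map $P:\mathcal{M}(\mathcal{X})\to\mathcal{M}(\mathcal{X})$ with $P(\lambda_1\mu_1+\lambda_2\mu_2)=\lambda_1P\mu_1+\lambda_2P\mu_2$ for $\lambda_1,\lambda_2\ge0$, $\mu_1,\mu_2\in\mathcal M(\mathcal X)$, and $P\mu(\mathcal{X})=\mu(\mathcal{X})$. It is regular if there is a linear operator on $B_b(\mathcal{X})$, also denoted $P$, with $\langle f,P\mu\rangle=\langle Pf,\mu\rangle$ for all $f\in B_b(\mathcal{X})$, $\mu\in\mathcal{M}(\mathcal{X})$. It is Markov-Feller if it is regular and $P(C_b(\mathcal{X}))\subset C_b(\mathcal{X})$. A Markov-Feller semigroup $\{P_t\}_{t\in T}$ is a semigroup ($P_{s+t}=P_sP_t$, and $P_0=\mathrm{Id}$ if $0\in T$)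 of Markov-Feller operators. Write $P_t(x,\cdot)=P_t\delta_x$. A measure $\mu\in\mathcal{P}(\mathcal{X})$ is invariant if $P_t\mu=\mu$ for all $t\in T$; ergodic measure means ergodic invariant probability measure in the usual sense. Restriction to $\mathcal{X}_\mu$: $\mathcal{X}_\mu$ is closed, hence Polish, and it is a known fact that $P_t(x,\mathcal{X}_\mu)=1$ for all $x\in\mathcal{X}_\mu$, $t\in T$; so $\{P_t\}_{t\in T}$ restricts to a Markov-Feller semigroup on $\mathcal{X}_\mu$, given by $P_tf(x)=\int_{\mathcal{X}_\mu}f(y)\,P_t(x,dy)$ for $x\in\mathcal{X}_\mu$, $f\in B_b(\mathcal{X}_\mu)$. Strong continuity on $C_b(\mathcal{X})$ (for $T=\mathbb{R}_+$): $\lim_{t\searrow0}\|P_tf-f\|_\infty=0$ for every $f\in C_b(\mathcal{X})$. Eventual continuity at $z\in\mathcal X$: for every $f\in L_b(\mathcal{X})$, $\limsup_{x\to z}\limsup_{t\to\infty}|P_tf(x)-P_tf(z)|=0$. *)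

(* Defs.v *)
From HB Require Import structures.
From mathcomp Require Import all_boot all_order all_algebra.
From mathcomp Require Import all_classical all_reals all_analysis.

Set Implicit Arguments.
Unset Strict Implicit.
Unset Printing Implicit Defensive.

Import Order.TTheory GRing.Theory Num.Theory.
Import numFieldNormedType.Exports.

Local Open Scope classical_set_scope.
Local Open Scope ring_scope.

(* The library's completeness interface is for pointed, hence nonempty,
   spaces. *)
#[short(type="completeMetricType")]
HB.structure Definition CompleteMetric (R : numDomainType) :=
  { M of CompletePseudoMetric R M & Metric R M }.

Definition separable (X : topologicalType) : Prop :=
  exists D : set X, countable D /\ dense D.

Section set_type_metric.
Context {R : realType} {X : metricType R} (A : set X).

Let sdist (x y : A) : R := mdist (val x) (val y).

Let sdist_ge0 x y : 0 <= sdist x y.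
Proof. exact: mdist_ge0. Qed.

Let sdist_positivity x y : sdist x y = 0 -> x = y.
Proof. by move=> /mdist_positivity /val_inj. Qed.

Let ballEsdist (x : A) d : ball x d = [set y | sdist x y < d].
Proof. by rewrite -initial_ballE ballEmdist. Qed.

HB.instance Definition _ :=
  @PseudoMetric_isMetric.Build R (set_type A)
    sdist sdist_ge0 sdist_positivity ballEsdist.

End set_type_metric.

Section function_spaces.
Context {R : realType}.

Definition Cb (X : topologicalType) (f : X -> R) : Prop :=
  continuous f /\ bounded_fun f.

Definition Lb (X : metricType R) (f : X -> R) : Prop :=
  (exists K : R, forall x y, `|f x - f y| <= K * mdist x y) /\ bounded_fun f.

(* Only meaningful for bounded g. *)
Definition sup_norm (X : Type) (g : X -> R) : R := sup (range (fun x => `|g x|)).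

End function_spaces.

Notation borel X := (g_sigma_algebraType (@open X)).

Section markov.
Context {R : realType} {X : completeMetricType R}.

Definition Bb (f : X -> R) : Prop :=
  measurable_fun [set: borel X] f /\ bounded_fun f.

Local Notation meas := {finite_measure set (borel X) -> \bar R}.

(* Two inhabitants of the type of finite measures may differ on nonmeasurable
   sets, so all identities between measures are tested on Borel sets. *)
Definition is_markov_operator (P : meas -> meas) : Prop :=
  (forall (a b : R) (mu1 mu2 nu : meas), 0 <= a -> 0 <= b ->
     (forall A, measurable A -> nu A = a%:E * mu1 A + b%:E * mu2 A)%E ->
     (forall A, measurable A ->
        P nu A = a%:E * P mu1 A + b%:E * P mu2 A)%E) /\
  (forall mu : meas, P mu setT = mu setT).

Definition is_dual (P : meas -> meas) (U : (X -> R) -> X -> R) : Prop :=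
  [/\ (forall f, Bb f -> Bb (U f)),
      (forall (a b : R) f g, Bb f -> Bb g ->
         U (fun x => a * f x + b * g x) = (fun x => a * U f x + b * U g x)) &
      (forall f (mu : meas), Bb f ->
         \int[P mu]_x f x = \int[mu]_x U f x)].

(* mf_fun is determined on Bb by mf_meas (test duality on Dirac masses); its
   values outside Bb are irrelevant. *)
Record markovFeller : Type := MarkovFeller {
  mf_meas :> meas -> meas ;
  mf_fun : (X -> R) -> X -> R ;
  _ : is_markov_operator mf_meas ;
  _ : is_dual mf_meas mf_fun ;
  _ : forall f, Cb f -> Cb (mf_fun f)
}.

(* The time set T is a subset of R; values P t with t outside T are
   irrelevant. *)
Section semigroup.
Variables (T : set R) (P : R -> markovFeller).

Definition is_semigroup : Prop :=
  (forall s t, T s -> T t -> forall (mu : meas) A, measurable A ->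
     P (s + t) mu A = P s (P t mu) A) /\
  (T 0 -> forall (mu : meas) A, measurable A -> P 0 mu A = mu A).

Definition strongly_continuous : Prop :=
  forall f, Cb f ->
    sup_norm (fun x => mf_fun (P t) f x - f x) @[t --> 0^'+] --> 0.

(* nbhs z contains z itself; the function vanishes there, so this is the usual
   limsup except that it is 0 rather than -oo at an isolated point. *)
Definition eventually_continuous_at (z : X) : Prop :=
  forall f, Lb f ->
    limf_esup (fun x =>
      limf_esup (fun t => `|mf_fun (P t) f x - mf_fun (P t) f z|%:E)
        (within T (pinfty_nbhs R)))
      (nbhs z) = 0%E.

Definition invariant_measure (mu : probability (borel X) R) : Prop :=
  forall t, T t -> forall A, measurable A -> P t mu A = mu A.

Definition ergodic_measure (mu : probability (borel X) R) : Prop :=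
  invariant_measure mu /\
  forall A : set (borel X), measurable A ->
    (forall t, T t -> {ae mu, forall x, mf_fun (P t) \1_A x = \1_A x}) ->
    mu A = 0%E \/ mu A = 1%E.

End semigroup.

Definition supp (mu : probability (borel X) R) : set X :=
  [set x | forall e : R, 0 < e -> (0 < mu (ball x e))%E].

Definition restrict_fun (P : markovFeller) (A : set X) (f : A -> R) (x : A) : R :=
  \int[P (\d_(val x : borel X))]_(y in A) 'valL_ 0 f y.

End markov.

Arguments markovFeller {R} X.

Definition e_property {R : realType} (Y : metricType R) (T : set R)
    (Q : R -> (Y -> R) -> Y -> R) : Prop :=
  forall (z : Y) (f : Y -> R), Lb f ->
    limf_esup (fun x => ereal_sup [set `|Q t f x - Q t f z|%:E | t in T])
      (nbhs z) = 0%E.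

Definition Nplus (R : realType) : set R := range (fun n : nat => n.+1%:R).

Definition Rplus (R : realType) : set R := [set t | 0 <= t].

Arguments Nplus R : clear implicits.
Arguments Rplus R : clear implicits.

(* Main.v *)
Require Import Defs.
From mathcomp Require Import all_boot all_order all_algebra.
From mathcomp Require Import all_classical all_reals all_analysis.
From mathcomp Require Import measurable_realfun ring lra.

(** Write [U t] for the dual semigroup, [S] for the support of [mu], and let [F]
    be bounded and Lipschitz. The claim is that the functions [U t F], with [t]
    in [T], are equicontinuous on [S].

    Eventual continuity already compares the orbits of two points at late
    times, but how late depends on the points. The Baire theorem on the
    complete space [S] removes this dependence on one small ball: there are a
    point of [S], a ball [B] around it and a time after which [U t F] varies by
    at most [eps] on the part of [S] in [B] ([equicontinuous_ball]). Nothing is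
    known about the position of [B], so the good behaviour has to be carried
    from [B] to an arbitrary point [z] of [S].

    The process started in [S] stays in [S] ([supp_absorbing]) and from every
    point of [S] it visits [B], with a probability bounded below at a suitable
    time ([support_recurrent]). The proof applies ergodicity to the upper limit
    of [U t phi], where [phi] is a bump function supported in [B]; eventual
    continuity is what makes this upper limit a continuous function. Since the
    lower bound is uniform over [S], stopping the process with probability
    [phi] at sufficiently many deterministic times leaves an arbitrarily small
    probability of survival from [z] ([survival_small]).

    If the process is stopped in [B], the rest of its evolution contributes a
    number that depends almost only on the remaining time. So at late times
    [U t F] is, near [z], a combination with bounded coefficients of finitely
    many fixed continuous functions (the probabilities of being stopped at the
    various times), up to an error governed by [eps] and by the survival
    probability ([spanned_up_to_survival]). Such combinations are
    equicontinuous ([spanned_equicontinuous]). In continuous time the stopping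
    times are taken from finer and finer grids: in an ergodic semigroup such as
    the rotations of a circle, the process observed at the multiples of one
    time may never visit [B].

    At bounded times, strong continuity reduces the claim to finitely many
    operators [U t], each of which preserves continuity. *)

Set Implicit Arguments.
Unset Strict Implicit.
Unset Printing Implicit Defensive.

Import Order.TTheory GRing.Theory Num.Theory.
Import numFieldNormedType.Exports.

Local Open Scope classical_set_scope.
Local Open Scope ring_scope.

(** * Bounded Borel and bounded continuous functions *)
Section bounded_borel.
Context {R : realType} {X : completeMetricType R}.
Implicit Types f g : X -> R.

Lemma bounded_funP (T : Type) (f : T -> R) :
  bounded_fun f <-> exists M, forall x, `|f x| <= M.
Proof.
split=> [[M [_ HM]]|[M HM]].
  exists (M + 1) => x; have := HM (M + 1); rewrite ltrDl ltr01 => /(_ isT x I).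
  exact.
exists M; split=> [|N MN x _]; first exact: num_real.
exact: le_trans (HM x) (ltW MN).
Qed.

Lemma continuous_borel f : continuous f -> measurable_fun [set: borel X] f.
Proof.
move=> cf.
apply: (measurability _ (measurable_realfun.RGenOInfty.measurableE R)).
move=> _ [_ [a ->] <-]; rewrite setTI; apply: sub_sigma_algebra.
by apply: open_comp => [x _|]; [exact: cf|exact: interval_open].
Qed.

Lemma open_borel (A : set X) : open A -> measurable (A : set (borel X)).
Proof. by move=> oA; exact: sub_sigma_algebra. Qed.

Lemma Cb_Bb f : Cb f -> Bb f.
Proof. by case=> cf bf; split=> //; exact: continuous_borel. Qed.

Lemma Bb_bound f : Bb f -> exists2 M, 0 <= M & forall x, `|f x| <= M.
Proof.
case=> _ /bounded_funP[M HM]; exists `|M| => // x.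
by rewrite (le_trans (HM x))// ler_norm.
Qed.

Lemma superlevel_borel f a : continuous f ->
  measurable ([set x | a < f x] : set (borel X)).
Proof.
move=> cf; apply: open_borel.
by apply: (@open_comp _ _ f [set y | a < y]) => [x _|];
  [exact: cf|exact: open_gt].
Qed.

Lemma Bb_of_bound M f : measurable_fun [set: borel X] f ->
  (forall x, `|f x| <= M) -> Bb f.
Proof. by move=> mf HM; split=> //; apply/bounded_funP; exists M. Qed.

Lemma Bb_cst (c : R) : @Bb R X (fun=> c).
Proof. by apply: (@Bb_of_bound `|c|) => //; exact: measurable_cst. Qed.

Lemma BbD f g : Bb f -> Bb g -> Bb (fun x => f x + g x).
Proof.
move=> Bf Bg; have [M _ HM] := Bb_bound Bf; have [N _ HN] := Bb_bound Bg.
apply: (@Bb_of_bound (M + N)).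
  by apply: measurable_funD; [case: Bf|case: Bg].
by move=> x; rewrite (le_trans (ler_normD _ _))// lerD.
Qed.

Lemma BbM f g : Bb f -> Bb g -> Bb (fun x => f x * g x).
Proof.
move=> Bf Bg; have [M _ HM] := Bb_bound Bf; have [N _ HN] := Bb_bound Bg.
apply: (@Bb_of_bound (M * N)).
  by apply: measurable_funM; [case: Bf|case: Bg].
by move=> x; rewrite normrM ler_pM.
Qed.

Lemma BbZ (a : R) f : Bb f -> Bb (fun x => a * f x).
Proof. by move=> Bf; apply: BbM => //; exact: Bb_cst. Qed.

Lemma BbB f g : Bb f -> Bb g -> Bb (fun x => f x - g x).
Proof.
move=> Bf Bg; have -> : (fun x => f x - g x) = (fun x => f x + -1 * g x).
  by apply/funext => x; rewrite mulN1r.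
by apply: BbD => //; exact: BbZ.
Qed.

Lemma Bb_max f g : Bb f -> Bb g -> Bb (fun x => Num.max (f x) (g x)).
Proof.
move=> Bf Bg; have [M M0 HM] := Bb_bound Bf; have [N N0 HN] := Bb_bound Bg.
apply: (@Bb_of_bound (M + N)).
  by apply: measurable_maxr; [case: Bf|case: Bg].
move=> x; have := HM x; have := HN x; rewrite maxEle.
by case: ifP => _; lra.
Qed.

Lemma Bb_indic (A : set X) : measurable (A : set (borel X)) ->
  Bb (\1_A : X -> R).
Proof.
move=> mA; apply: (@Bb_of_bound 1); first exact: measurable_indic.
by move=> x; rewrite indicE; case: (x \in A); rewrite /= ?normr1 ?normr0.
Qed.

Lemma Bb_integrable (m : {measure set (borel X) -> \bar R})
    (A : set (borel X)) f :
  (m setT < +oo)%E -> measurable A -> Bb f -> m.-integrable A (EFin \o f).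
Proof.
move=> mfin mA Bf; apply: measurable_bounded_integrable => //.
- by rewrite (le_lt_trans _ mfin)// le_measure// inE.
- by apply: measurable_funTS; case: Bf.
- have [M _ HM] := Bb_bound Bf.
  exists M; split=> [|N MN x _]; first exact: num_real.
  exact: le_trans (HM x) (ltW MN).
Qed.

End bounded_borel.

Section continuous_bounded.
Context {R : realType} {X : topologicalType}.
Implicit Types f g : X -> R.

Lemma Cb_of_bound M f : continuous f -> (forall x, `|f x| <= M) -> Cb f.
Proof. by move=> cf HM; split=> //; apply/bounded_funP; exists M. Qed.

Lemma Cb_bound f : Cb f -> exists2 M, 0 <= M & forall x, `|f x| <= M.
Proof.
case=> _ /bounded_funP[M HM]; exists `|M| => // x.
by rewrite (le_trans (HM x))// ler_norm.
Qed.

Lemma Cb_cst (c : R) : @Cb R X (fun=> c).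
Proof. by apply: (@Cb_of_bound `|c|) => // x; exact: cvg_cst. Qed.

Lemma CbD f g : Cb f -> Cb g -> Cb (fun x => f x + g x).
Proof.
move=> Bf Bg; have [M _ HM] := Cb_bound Bf; have [N _ HN] := Cb_bound Bg.
apply: (@Cb_of_bound (M + N)).
  move=> x; apply: cvgD; first by case: Bf => + _; exact.
  by case: Bg => + _; exact.
by move=> x; rewrite (le_trans (ler_normD _ _))// lerD.
Qed.

Lemma CbM f g : Cb f -> Cb g -> Cb (fun x => f x * g x).
Proof.
move=> Bf Bg; have [M _ HM] := Cb_bound Bf; have [N _ HN] := Cb_bound Bg.
apply: (@Cb_of_bound (M * N)).
  move=> x; apply: cvgM; first by case: Bf => + _; exact.
  by case: Bg => + _; exact.
by move=> x; rewrite normrM ler_pM.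
Qed.

Lemma CbB f g : Cb f -> Cb g -> Cb (fun x => f x - g x).
Proof.
move=> Cf Cg; have -> : (fun x => f x - g x) = (fun x => f x + -1 * g x).
  by apply/funext => x; rewrite mulN1r.
by apply: CbD => //; apply: CbM => //; exact: Cb_cst.
Qed.

Lemma Cb_max f g : Cb f -> Cb g -> Cb (fun x => Num.max (f x) (g x)).
Proof.
move=> Cf Cg; have [M M0 HM] := Cb_bound Cf; have [N N0 HN] := Cb_bound Cg.
apply: (@Cb_of_bound (M + N)).
  move=> x; apply: continuous_max; first by case: Cf => + _; exact.
  by case: Cg => + _; exact.
move=> x; have := HM x; have := HN x; rewrite maxEle.
by case: ifP => _; lra.
Qed.

Lemma Cb_min f g : Cb f -> Cb g -> Cb (fun x => Num.min (f x) (g x)).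
Proof.
move=> Cf Cg; have -> : (fun x => Num.min (f x) (g x)) =
    (fun x => f x + g x - Num.max (f x) (g x)).
  by apply/funext => x; rewrite -(addr_max_min (f x) (g x)) addrC addKr.
by apply: CbB; [exact: CbD|exact: Cb_max].
Qed.

End continuous_bounded.

(** * Integrals against a measure of mass one *)
(** The integrals are total over the space, but inequalities and limits of the
    integrands are only asked on a set [S] of full mass. *)
Section unit_mass.
Context {R : realType} {X : completeMetricType R}.
Variables (m : {measure set (borel X) -> \bar R}) (S : set (borel X)).
Hypotheses (m1 : m setT = 1%E) (mS : measurable S) (mSC : m (~` S) = 0%E).
Implicit Types f g : X -> R.

Let mfin : (m setT < +oo)%E. Proof. by rewrite m1 ltry. Qed.

Lemma mean_on f : Bb f -> \int[m]_x f x = \int[m]_(x in S) f x.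
Proof.
move=> Bf; congr fine; rewrite (@negligible_integral _ _ _ _ _ (~` S))//.
- by rewrite setTD setCK.
- exact: measurableC.
- exact: Bb_integrable.
Qed.

Lemma mean_cst (c : R) : \int[m]_x c = c.
Proof. by rewrite Rintegral_cst// m1 mulr1. Qed.

Lemma meanD f g : Bb f -> Bb g ->
  \int[m]_x (f x + g x) = \int[m]_x f x + \int[m]_x g x.
Proof. by move=> Bf Bg; rewrite RintegralD//; exact: Bb_integrable. Qed.

Lemma meanZ (a : R) f : Bb f -> \int[m]_x (a * f x) = a * \int[m]_x f x.
Proof. by move=> Bf; rewrite RintegralZl//; exact: Bb_integrable. Qed.

Lemma meanB f g : Bb f -> Bb g ->
  \int[m]_x (f x - g x) = \int[m]_x f x - \int[m]_x g x.
Proof. by move=> Bf Bg; rewrite RintegralB//; exact: Bb_integrable. Qed.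

Lemma le_mean f g : Bb f -> Bb g -> (forall x, S x -> f x <= g x) ->
  \int[m]_x f x <= \int[m]_x g x.
Proof.
move=> Bf Bg fg; rewrite !mean_on//.
by apply: le_Rintegral => //; exact: Bb_integrable.
Qed.

Lemma mean_cvg (f_ : nat -> X -> R) f C :
  (forall n, Bb (f_ n)) -> Bb f -> (forall n x, `|f_ n x| <= C) ->
  (forall x, S x -> f_ ^~ x @ \oo --> f x) ->
  (fun n => \int[m]_x f_ n x) @ \oo --> \int[m]_x f x.
Proof.
move=> Bf_ Bf HC ff.
have -> : (fun n => \int[m]_x f_ n x) = (fun n => \int[m]_(x in S) f_ n x).
  by apply/funext => n; rewrite mean_on.
rewrite mean_on//; apply: fine_cvg; rewrite fineK; last first.
  by apply: integrable_fin_num => //; exact: Bb_integrable.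
have := @dominated_cvg _ _ _ m S mS (fun n => EFin \o f_ n) (EFin \o f)
  (EFin \o cst C).
apply => //.
- by move=> n; apply/measurable_EFinP; apply: measurable_funTS; case: (Bf_ n).
- by move=> x Sx; apply: cvg_EFin; [exact: nearW|exact: ff].
- by apply: Bb_integrable => //; exact: Bb_cst.
- by move=> n x _; rewrite /= lee_fin.
Qed.

End unit_mass.

(** * Functions and closed sets in metric spaces *)
Section epsilon_delta.
Context {R : realType}.

Lemma real_cvgP (u : nat -> R) (l : R) : u @ \oo --> l <->
  forall e, 0 < e -> exists N, forall n, (N <= n)%N -> `|u n - l| < e.
Proof.
rewrite cvgrPdistC_lt; split=> H e e0.
  by have [N _ HN] := H e e0; exists N.
by have [N HN] := H e e0; exists N.
Qed.

Lemma nbhs_mdist (X : metricType R) (x : X) (A : set X) :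
  nbhs x A <-> exists2 d, 0 < d & forall y, mdist x y < d -> A y.
Proof.
rewrite nbhs_ballP; split=> -[d d0 H]; exists d => // y.
  by move=> xy; apply: H; rewrite ballEmdist.
by rewrite ballEmdist => xy; exact: H.
Qed.

Lemma continuous_mdistP (X : metricType R) (f : X -> R) : continuous f <->
  forall x e, 0 < e ->
    exists2 d, 0 < d & forall y, mdist x y < d -> `|f y - f x| < e.
Proof.
split=> [cf x e e0|H x].
  by have /cvgrPdistC_lt/(_ e e0)/nbhs_mdist := cf x.
by apply/cvgrPdistC_lt => e /(H x) ?; apply/nbhs_mdist.
Qed.

Lemma open_mdist (X : metricType R) (A : set X) :
  (forall x, A x -> exists2 d, 0 < d & forall y, mdist x y < d -> A y) ->
  open A.
Proof. by move=> H; rewrite openE => x /H ?; apply/nbhs_mdist. Qed.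

Lemma ball_mdist (X : metricType R) (x : X) e y : ball x e y = (mdist x y < e).
Proof. by rewrite ballEmdist. Qed.

Lemma open_mball (X : metricType R) (x : X) e : open (ball x e).
Proof.
apply: open_mdist => y; rewrite ball_mdist => xy; exists (e - mdist x y).
  by rewrite subr_gt0.
move=> z yz; rewrite ball_mdist.
by have := metric_triangle x y z; lra.
Qed.

Lemma Lb_Cb (X : metricType R) (f : X -> R) : Lb f -> Cb f.
Proof.
case=> -[K HK] bf; split=> //; apply/continuous_mdistP => x e e0.
exists (e / (`|K| + 1)); first by rewrite divr_gt0// ltr_wpDl.
move=> y; rewrite ltr_pdivlMr ?ltr_wpDl// metric_sym => xy.
apply: le_lt_trans xy; apply: le_trans (HK y x) _.
rewrite mulrC ler_wpM2l ?mdist_ge0//.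
by have := ler_norm K; lra.
Qed.

(** The two clauses characterize the upper limit of [g] along [T]; they spare
    all computations with infima of suprema. *)
Lemma limsup_of_bounded (T : set R) (g : R -> R) M : (forall t, `|g t| <= M) ->
  (forall n : nat, exists2 t, T t & n%:R <= t) ->
  exists l,
    (forall e, 0 < e ->
       exists N : nat, forall t, T t -> N%:R <= t -> g t <= l + e) /\
    (forall e (N : nat), 0 < e ->
       exists t, [/\ T t, N%:R <= t & l - e <= g t]).
Proof.
move=> gM Tinf.
pose A := [set a | forall N : nat, exists t, [/\ T t, N%:R <= t & a <= g t]].
have A0 : A (- M).
  move=> N; have [t Tt Nt] := Tinf N; exists t; split=> //.
  by have := gM t; rewrite ler_norml => /andP[].
have AM : ubound A M.
  move=> a /(_ 0%N)[t [_ _ H]]; apply: le_trans H _.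
  by have := gM t; rewrite ler_norml => /andP[].
have supA : has_sup A by split; [exists (- M)|exists M].
exists (sup A); split.
  move=> e e0; apply: contrapT => /forallNP H.
  have : A (sup A + e).
    move=> N; have /existsNP[t /not_implyP[Tt /not_implyP[Nt /negP]]] := H N.
    by rewrite -ltNge => /ltW ?; exists t.
  by move=> /(ub_le_sup supA.2); lra.
move=> e N e0; have [a Aa sa] := sup_adherent e0 supA.
have [t [Tt Nt at_]] := Aa N; exists t; split=> //.
by apply: le_trans at_; exact: ltW.
Qed.

End epsilon_delta.

Section mcshane.
Context {R : realType} {X : metricType R} (S : set X).

(** Take the infimum of the [K]-Lipschitz functions [f y + K * mdist y _].
    Cutting each of them at the bound [M] of [f] does not change the values on
    [S] and makes the infimum bounded. *)
Lemma McShane (f : S -> R) (s0 : S) : Lb f ->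
  exists2 F : X -> R, Lb F & forall y : S, F (val y) = f y.
Proof.
case=> -[K0 HK0] /bounded_funP[M HM].
pose K := `|K0|; have Kge0 : 0 <= K by exact: normr_ge0.
have HK (x y : S) : `|f x - f y| <= K * mdist (val x) (val y).
  by apply: le_trans (HK0 x y) _; rewrite ler_wpM2r// ?mdist_ge0// ler_norm.
pose h x (y : S) := Num.min M (f y + K * mdist (val y) x).
pose F x := inf (range (h x)).
have hlb x y : - M <= h x y.
  have := HM y; rewrite ler_norml => /andP[? ?].
  have : 0 <= K * mdist (val y) x by rewrite mulr_ge0// mdist_ge0.
  by rewrite /h le_min => ?; apply/andP; split; lra.
have hinf x : has_inf (range (h x)).
  by split; [exists (h x s0); exists s0|exists (- M) => _ [y _ <-]].
have Fle x y : F x <= h x y by apply: ge_inf; [exact: (hinf x).2|exists y].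
have leF x c : (forall y, c <= h x y) -> c <= F x.
  by move=> H; apply: lb_le_inf; [exact: (hinf x).1|move=> _ [y _ <-]].
have Flip x y : F x - F y <= K * mdist x y.
  rewrite lerBlDr -lerBlDl; apply: leF => z; rewrite lerBlDl.
  apply: le_trans (Fle x z) _; rewrite /h.
  have dxy : 0 <= K * mdist x y by rewrite mulr_ge0// mdist_ge0.
  rewrite addr_minr le_min; apply/andP; split.
    by rewrite ge_min lerDr dxy.
  rewrite ge_min; apply/orP; right.
  have : K * mdist (val z) x <= K * (mdist (val z) y + mdist x y).
    by rewrite ler_wpM2l// (metric_sym x y) metric_triangle.
  by lra.
exists F.
  split.
    exists K => x y; rewrite ler_norml; apply/andP; split; last exact: Flip.
    by have := Flip y x; rewrite metric_sym; lra.
  apply/bounded_funP; exists M => x; rewrite ler_norml leF//=.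
  by apply: le_trans (Fle x s0) _; rewrite /h ge_min lexx.
move=> y; apply/eqP; rewrite eq_le; apply/andP; split.
  apply: le_trans (Fle _ y) _.
  by rewrite /h mdistxx mulr0 addr0 ge_min lexx orbT.
apply: leF => z; rewrite /h le_min; apply/andP; split.
  by have := HM y; rewrite ler_norml => /andP[].
by have := HK y z; rewrite ler_norml metric_sym => /andP[]; lra.
Qed.

End mcshane.

Section baire.
Context {R : realType} {X : completeMetricType R}.

(** The Baire category theorem for the complete subspace [S], with all sets
    taken in the ambient space. If no [A n] contained a relative ball of [S],
    one could shrink balls centred in [S] so that the [n]-th avoids [A n]; their
    common point would lie in none of the [A n]. *)
Lemma Baire_closed (S : set X) (A : nat -> set X) x0 d :
  closed S -> (forall n, closed (A n)) -> S x0 -> 0 < d ->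
  (forall x, S x -> mdist x0 x < d -> exists n, A n x) ->
  exists n y r, [/\ S y, 0 < r & forall x, S x -> mdist y x < r -> A n x].
Proof.
move=> cS cA Sx0 d0 cover; apply: contrapT => nint.
have step (np : nat * (X * R)) : exists p' : X * R, S np.2.1 -> 0 < np.2.2 ->
    [/\ S p'.1, 0 < p'.2, p'.2 <= np.1.+1%:R^-1 &
    forall w, mdist p'.1 w <= p'.2 -> ~ A np.1 w /\ mdist np.2.1 w < np.2.2].
  case: np => n [y r] /=.
  have [[Sy r0]|/not_andP nSr] := pselect (S y /\ 0 < r); last first.
    by exists (y, r) => ? ?; case: nSr.
  have [x [Sx yx nAx]] : exists x, [/\ S x, mdist y x < r & ~ A n x].
    apply: contrapT => H; apply: nint; exists n, y, r; split=> // x Sx yx.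
    by apply: contrapT => nA; apply: H; exists x.
  have /nbhs_mdist[s s0 Hs] : nbhs x (~` A n).
    by apply: open_nbhs_nbhs; split=> //; exact: closed_openC.
  (* The halves leave room for the next closed ball inside the open one. *)
  pose q := Num.min n.+1%:R^-1 (Num.min (s / 2) ((r - mdist y x) / 2)).
  exists (x, q) => _ _ /=; split=> //.
  - by rewrite !lt_min invr_gt0 ltr0n /=; apply/andP; split; lra.
  - by rewrite ge_min lexx.
  - move=> w; rewrite !le_min => /and3P[_ xw1 xw2]; split.
      by apply: Hs; lra.
    by have := metric_triangle y x w; lra.
have [f Hf] := choice step.
pose fix p n : X * R := if n is m.+1 then f (m, p m) else (x0, d).
have pP n : S (p n).1 /\ 0 < (p n).2.
  by elim: n => [//|n [IH1 IH2]]; have [] := Hf (n, p n) IH1 IH2.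
have pS n : (p n.+1).2 <= n.+1%:R^-1 /\
    forall w, mdist (p n.+1).1 w <= (p n.+1).2 ->
      ~ A n w /\ mdist (p n).1 w < (p n).2.
  by have [IH1 IH2] := pP n; have [] := Hf (n, p n) IH1 IH2.
have nest n k w : mdist (p (k + n)%N).1 w <= (p (k + n)%N).2 ->
    mdist (p n).1 w <= (p n).2.
  elim: k => [//|k IH] H; apply: IH; apply: ltW.
  by have [_ /(_ _ H)[]] := pS (k + n)%N.
have close n m : (n <= m)%N -> mdist (p n).1 (p m).1 <= (p n).2.
  move=> nm; apply: (nest n (m - n)%N); rewrite subnK// mdistxx.
  by apply: ltW; case: (pP m).
pose a n := (p n).1.
have : cvg (a @ \oo).
  apply: cauchy_cvg; apply: cauchy_exP => e e0.
  have [n ne] : exists n, n.+1%:R^-1 < e.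
    exists (Num.truncn e^-1).
    by rewrite invf_plt ?posrE//; exact: truncnS_gt.
  exists (a n.+1); exists n.+1 => // m /= nm.
  rewrite ball_mdist; apply: le_lt_trans (close _ _ nm) _.
  by apply: le_lt_trans ne; case: (pS n).
move=> /cvg_ex[l al].
have Sl : S l.
  apply: (@closed_cvg _ _ \oo _ a S cS _ l al).
  by apply: nearW => n; case: (pP n).
have inl n : mdist (p n).1 l <= (p n).2.
  apply/ler_addgt0Pr => e e0.
  have [N _ HN] := (al _ (nbhsx_ballx l e e0)).
  have := HN (maxn N n) (leq_maxl _ _); rewrite /= ball_mdist metric_sym => H1.
  have := close n (maxn N n) (leq_maxr _ _).
  by have := metric_triangle (p n).1 (a (maxn N n)) l; rewrite /a in H1 *; lra.
have [_ H] := pS 0%N; have [_ /= xl] := H _ (inl 1%N).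
have [n An] := cover l Sl xl.
by have [_ /(_ _ (inl n.+1))[]] := pS n.
Qed.

End baire.

(** * Markov-Feller operators *)
Section markov_feller_operator.
Context {R : realType} {X : completeMetricType R}.
Implicit Types (f g : X -> R) (Q : markovFeller X) (x : X).

Lemma mf_dual Q : is_dual Q (mf_fun Q).
Proof. by case: Q. Qed.

Lemma mf_Cb Q f : Cb f -> Cb (mf_fun Q f).
Proof. by case: Q => ? ? ? ? /= H; exact: H. Qed.

Lemma mf_Bb Q f : Bb f -> Bb (mf_fun Q f).
Proof. by case: (mf_dual Q) => H _ _; exact: H. Qed.

Definition kernel_at Q x := Q (\d_(x : borel X)).

Lemma kernel_at_mass Q x : kernel_at Q x setT = 1%E.
Proof.
rewrite /kernel_at; case: Q => [Q U [_ H] HU HC] /=; rewrite H.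
exact: diracT.
Qed.

Lemma mf_funE Q f x : Bb f -> mf_fun Q f x = \int[kernel_at Q x]_y f y.
Proof.
move=> Bf; case: (mf_dual Q) => _ _ /(_ f _ Bf) ->.
rewrite /Rintegral integral_dirac//.
  by rewrite diracT mul1e.
by apply/measurable_EFinP; case: (mf_Bb Q Bf).
Qed.

Lemma mf_cst Q c : mf_fun Q (fun=> c) = (fun=> c).
Proof.
apply/funext => x; rewrite mf_funE; last exact: Bb_cst.
by rewrite mean_cst//; exact: kernel_at_mass.
Qed.

Lemma mfD Q f g x : Bb f -> Bb g ->
  mf_fun Q (fun x => f x + g x) x = mf_fun Q f x + mf_fun Q g x.
Proof.
move=> Bf Bg; rewrite !mf_funE//; last exact: BbD.
by rewrite meanD//; exact: kernel_at_mass.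
Qed.

Lemma mfZ Q a f x : Bb f -> mf_fun Q (fun x => a * f x) x = a * mf_fun Q f x.
Proof.
move=> Bf; rewrite !mf_funE//; last exact: BbZ.
by rewrite meanZ//; exact: kernel_at_mass.
Qed.

Lemma mfB Q f g x : Bb f -> Bb g ->
  mf_fun Q (fun x => f x - g x) x = mf_fun Q f x - mf_fun Q g x.
Proof.
move=> Bf Bg; rewrite !mf_funE//; last exact: BbB.
by rewrite meanB//; exact: kernel_at_mass.
Qed.

Lemma mf_sum Q (n : nat) (a : nat -> R) (s : nat -> X -> R) x :
  (forall k, Bb (s k)) ->
  Bb (fun y => \sum_(k < n) a k * s k y) /\
  mf_fun Q (fun y => \sum_(k < n) a k * s k y) x =
  \sum_(k < n) a k * mf_fun Q (s k) x.
Proof.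
move=> Bs; elim: n => [|n [IHB IH]].
  rewrite big_ord0 (_ : (fun y => _) = fun=> 0).
    by rewrite mf_cst; split=> //; exact: Bb_cst.
  by apply/funext => y; rewrite big_ord0.
rewrite big_ord_recr/= (_ : (fun y => _) =
    fun y => \sum_(k < n) a k * s k y + a n * s n y).
  rewrite -IH -mfZ// -mfD//; last exact: BbZ.
  by split=> //; apply: BbD => //; exact: BbZ.
by apply/funext => y; rewrite big_ord_recr.
Qed.

(** A process that stays in [S] only sees the values of a function on [S]. *)
Section concentrated.
Variables (Q : markovFeller X) (S : set (borel X)) (x : X).
Hypotheses (mS : measurable S) (QS : kernel_at Q x (~` S) = 0%E).

Lemma le_mf_on f g : Bb f -> Bb g -> (forall y, S y -> f y <= g y) ->
  mf_fun Q f x <= mf_fun Q g x.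
Proof.
move=> Bf Bg fg; rewrite !mf_funE// (@le_mean _ _ _ S)//.
exact: kernel_at_mass.
Qed.

Lemma mf_norm_le_on f g : Bb f -> Bb g -> (forall y, S y -> `|f y| <= g y) ->
  `|mf_fun Q f x| <= mf_fun Q g x.
Proof.
move=> Bf Bg fg; rewrite ler_norml; apply/andP; split.
  rewrite -mulN1r -mfZ//; apply: le_mf_on => //; first exact: BbZ.
  by move=> y /fg; rewrite mulN1r ler_norml => /andP[].
by apply: le_mf_on => // y /fg; rewrite ler_norml => /andP[].
Qed.

Lemma mf_cvg_on (f_ : nat -> X -> R) f C :
  (forall n, Bb (f_ n)) -> Bb f -> (forall n y, `|f_ n y| <= C) ->
  (forall y, S y -> f_ ^~ y @ \oo --> f y) ->
  (fun n => mf_fun Q (f_ n) x) @ \oo --> mf_fun Q f x.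
Proof.
move=> Bf_ Bf HC ff; under eq_cvg do rewrite mf_funE//.
rewrite mf_funE//; apply: (@mean_cvg _ _ _ S) HC _ => //.
exact: kernel_at_mass.
Qed.

End concentrated.

Lemma le_mf Q f g x : Bb f -> Bb g -> (forall y, f y <= g y) ->
  mf_fun Q f x <= mf_fun Q g x.
Proof.
by move=> Bf Bg fg; apply: (@le_mf_on _ setT) => //; rewrite setCT measure0.
Qed.

Lemma mf_ge0 Q f x : Bb f -> (forall y, 0 <= f y) -> 0 <= mf_fun Q f x.
Proof. by move=> Bf f0; rewrite mf_funE//; apply: Rintegral_ge0. Qed.

Lemma mf_le_cst Q f c x : Bb f -> (forall y, f y <= c) -> mf_fun Q f x <= c.
Proof.
move=> Bf fc.
rewrite -[leRHS](_ : mf_fun Q (fun=> c) x = c); last by rewrite mf_cst.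
by apply: le_mf => //; exact: Bb_cst.
Qed.

Lemma mf_norm_le Q f c x : Bb f -> (forall y, `|f y| <= c) ->
  `|mf_fun Q f x| <= c.
Proof.
move=> Bf fc.
rewrite -[leRHS](_ : mf_fun Q (fun=> c) x = c); last by rewrite mf_cst.
apply: (@mf_norm_le_on _ setT) => //; first by rewrite setCT measure0.
exact: Bb_cst.
Qed.

Lemma mf_cvg Q (f_ : nat -> X -> R) f C x :
  (forall n, Bb (f_ n)) -> Bb f -> (forall n y, `|f_ n y| <= C) ->
  (forall y, f_ ^~ y @ \oo --> f y) ->
  (fun n => mf_fun Q (f_ n) x) @ \oo --> mf_fun Q f x.
Proof.
move=> Bf_ Bf HC ff; apply: (@mf_cvg_on _ setT) HC _ => //.
by rewrite setCT measure0.
Qed.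

End markov_feller_operator.

Section semigroup.
Context {R : realType} {X : completeMetricType R}.
Variables (T : set R) (P : R -> markovFeller X).
Hypothesis semiP : is_semigroup T P.

(** On measures [P (s + t)] is [P s] after [P t], hence the dual operators
    compose in the opposite order. *)
Lemma mf_semigroup s t f : T s -> T t -> Bb f ->
  mf_fun (P (s + t)) f = mf_fun (P t) (mf_fun (P s) f).
Proof.
move=> Ts Tt Bf; apply/funext => x.
rewrite mf_funE// [RHS]mf_funE//; last exact: mf_Bb.
case: (mf_dual (P s)) => _ _ /(_ f _ Bf) <-.
congr fine; apply: eq_measure_integral => A mA _.
by case: semiP => H _; exact: H.
Qed.

Lemma mf_semigroup0 f : T 0 -> Bb f -> mf_fun (P 0) f = f.
Proof.
move=> T0 Bf; apply/funext => x; rewrite mf_funE//.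
rewrite -[RHS](_ : \int[\d_(x : borel X)]_y f y = f x).
  congr fine; apply: eq_measure_integral => A mA _.
  by case: semiP => _ H; exact: H.
rewrite /Rintegral integral_dirac//; first by rewrite diracT mul1e.
by apply/measurable_EFinP; case: Bf.
Qed.

Lemma mean_invariant (mu : probability (borel X) R) t f :
  invariant_measure T P mu -> T t -> Bb f ->
  \int[mu]_x mf_fun (P t) f x = \int[mu]_x f x.
Proof.
move=> inv Tt Bf; case: (mf_dual (P t)) => _ _ /(_ f _ Bf) <-.
by congr fine; apply: eq_measure_integral => A mA _; exact: inv.
Qed.

End semigroup.

Section distance_to_closed.
Context {R : realType} {X : metricType R}.

(** The distance to [S], truncated at 1. *)
Lemma distance_function (S : set X) (s0 : X) : closed S -> S s0 ->
  exists h : X -> R, [/\ Cb h, forall x, 0 <= h x <= 1,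
    forall x, S x -> h x = 0 & forall x, ~ S x -> 0 < h x].
Proof.
move=> cS Ss0; pose g (x s : X) : R := Num.min 1 (mdist s x).
pose h (x : X) : R := inf [set g x s | s in S].
have g0 x s : 0 <= g x s by rewrite /g le_min ler01 mdist_ge0.
have hinf x : has_inf [set g x s | s in S].
  by split; [exists (g x s0); exists s0|exists 0 => _ [y _ <-]].
have hle x s : S s -> h x <= g x s.
  by move=> ?; apply: ge_inf; [exact: (hinf x).2|exists s].
have leh x c : (forall s, S s -> c <= g x s) -> c <= h x.
  by move=> H; apply: lb_le_inf; [exact: (hinf x).1|move=> _ [y /H ? <-]].
have h01 x : 0 <= h x <= 1.
  rewrite leh//=; apply: le_trans (hle x s0 Ss0) _.
  by rewrite /g ge_min lexx.
have hlip x y : h x - h y <= mdist x y.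
  rewrite lerBlDr -lerBlDl; apply: leh => z Sz; rewrite lerBlDl.
  apply: le_trans (hle x z Sz) _.
  rewrite /g addr_minr le_min; apply/andP; split.
    by rewrite ge_min lerDr mdist_ge0.
  by rewrite ge_min addrC (metric_sym x y) metric_triangle orbT.
exists h; split=> //.
- apply: Lb_Cb; split.
    exists 1 => x y; rewrite mul1r ler_norml hlip andbT.
    by have := hlip y x; rewrite metric_sym; lra.
  apply/bounded_funP; exists 1 => x; have /andP[? ?] := h01 x.
  by rewrite ger0_norm.
- move=> x Sx; apply/eqP; rewrite eq_le.
  have /andP[-> _] := h01 x; rewrite andbT.
  by apply: le_trans (hle x x Sx) _; rewrite /g mdistxx ge_min lexx orbT.
- move=> x nSx; have /nbhs_mdist[d d0 Hd] : nbhs x (~` S).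
    by apply: open_nbhs_nbhs; split=> //; exact: closed_openC.
  apply: (@lt_le_trans _ _ (Num.min 1 d)); first by rewrite lt_min ltr01.
  apply: leh => s Ss; rewrite /g le_min; rewrite ge_min lexx /= ge_min.
  apply/orP; right; rewrite leNgt; apply/negP => sd.
  by apply: (Hd s) => //; rewrite metric_sym.
Qed.

End distance_to_closed.

(** * The support of an invariant measure *)
Lemma ball_borel {R : realType} {X : completeMetricType R} (x : X) e :
  measurable (ball x e : set (borel X)).
Proof. exact: open_borel (open_mball x e). Qed.

Section support.
Context {R : realType} {X : completeMetricType R}.
Variable mu : probability (borel X) R.
Local Notation S := (supp mu).

Lemma supp_closed : closed S.
Proof.
rewrite -[S]setCK; apply: open_closedC; apply: open_mdist => x.
move=> /existsNP[e /not_implyP[e0 mue]].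
exists (e / 2); first by rewrite divr_gt0.
move=> y xy Sy; apply: mue; apply: lt_le_trans (Sy (e / 2) _) _.
  by rewrite divr_gt0.
apply: le_measure; rewrite ?inE; [exact: ball_borel..|].
move=> z; rewrite !ball_mdist => yz.
by have := metric_triangle x y z; lra.
Qed.

Lemma supp_borel : measurable (S : set (borel X)).
Proof.
rewrite -[S]setCK; apply: measurableC.
exact: open_borel (closed_openC supp_closed).
Qed.

(** A point outside the support has a null ball around it. By separability it
    lies in a null ball with centre in a countable dense set and radius
    [n.+1^-1], and there are countably many of these. *)
Lemma supp_null : separable X -> mu (~` S) = 0%E.
Proof.
move=> [D [cD dD]].
pose N (d : X) (n : nat) : set (borel X) :=
  if mu (ball d n.+1%:R^-1) == 0%E then ball d n.+1%:R^-1 else set0.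
have negN d n : mu.-negligible (N d n).
  rewrite /N; case: ifPn => [/eqP H|_]; last exact: negligible_set0.
  by apply/negligibleP => //; exact: ball_borel.
(* Indexing the dense set by an injection into nat turns the union over its
   points into a union over natural numbers with at most one point each. *)
have [f injf] : exists f : X -> nat, set_inj D f.
  have /pcard_leTP : (D #<= [set: nat])%card := cD.
  by move=> [f]; exists f; exact: inj.
suff : mu.-negligible (~` S).
  by move/negligibleP; apply; apply: measurableC; exact: supp_borel.
pose F (k : nat) := \bigcup_n \bigcup_(d in [set d | D d /\ f d = k]) N d n.
have negF k : mu.-negligible (F k).
  apply: negligible_bigcup => n.
  have [[d [Dd fd]]|nd] := pselect (exists d, D d /\ f d = k).
    apply: negligibleS (negN d n) => x [d' [Dd' fd'] Nx].
    by rewrite -(_ : d' = d)//; apply: injf; rewrite ?inE// fd fd'.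
  apply: negligibleS (@negligible_set0 _ _ _ mu) => x [d' Hd' _].
  by case: nd; exists d'.
apply: negligibleS (negligible_bigcup negF) => x.
move=> /existsNP[e /not_implyP[e0 /negP]]; rewrite -leNgt => mue.
have [n ne] : exists n : nat, n.+1%:R^-1 < e / 2.
  exists (Num.truncn (e / 2)^-1).
  by rewrite invf_plt ?posrE ?divr_gt0//; exact: truncnS_gt.
have n0 : 0 < n.+1%:R^-1 :> R by rewrite invr_gt0.
have [d [/= xd Dd]] := dD (ball x n.+1%:R^-1)
  (ex_intro _ x (ballxx x n0)) (open_mball _ _).
exists (f d) => //; exists n => //; exists d => //.
rewrite /N ifT.
  by apply: ball_sym.
rewrite -measure_le0; apply: le_trans mue; apply: le_measure;
  rewrite ?inE; [exact: ball_borel..|].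
move: xd; rewrite ball_mdist => xd z; rewrite !ball_mdist => dz.
have := metric_triangle x d z; move: xd dz ne.
by move: (n.+1%:R^-1 : R) => r; lra.
Qed.

Hypothesis sepX : separable X.
Let muS := supp_null sepX.
Let mS := supp_borel.
Let mu1 : mu setT = 1%E := probability_setT mu.

Lemma mean_indic (A : set (borel X)) : measurable A ->
  \int[mu]_x (\1_A x : R) = fine (mu A).
Proof. by move=> mA; rewrite /Rintegral integral_indic// setIT. Qed.

(** Continuity upgrades almost everywhere to everywhere on the support: a
    positive value persists on a ball, which has positive measure. *)
Lemma mean0_supp (g : X -> R) : Cb g -> (forall x, S x -> 0 <= g x) ->
  \int[mu]_x g x = 0 -> forall x, S x -> g x = 0.
Proof.
move=> Cg g0 ig x Sx; apply/eqP; rewrite eq_le g0// andbT leNgt.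
apply/negP => gx.
have [/continuous_mdistP/(_ x (g x / 2))] := Cg.
rewrite divr_gt0// => /(_ isT)[d d0 Hd] _.
have mB : measurable (ball x d : set (borel X)) by exact: ball_borel.
have : \int[mu]_y (g x / 2 * \1_(ball x d) y) <= \int[mu]_y g y.
  apply: (le_mean mu1 mS muS) => [||y Sy].
  - by apply: BbZ; exact: Bb_indic.
  - exact: Cb_Bb.
  - rewrite indicE; have [yB|yB] := pselect (ball x d y).
      rewrite mem_set// mulr1; move: yB; rewrite ball_mdist => /Hd.
      by rewrite ltr_norml => /andP[]; lra.
    by rewrite memNset// mulr0 g0.
rewrite (meanZ mu1)//; last exact: Bb_indic.
rewrite mean_indic// ig leNgt => /negP; apply.
rewrite mulr_gt0 ?divr_gt0//; apply: fine_gt0; rewrite Sx//=.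
by rewrite (le_lt_trans (probability_le1 _ _))// ltry.
Qed.

(** Let [h] be the distance to the support. Its mean vanishes, hence so does
    the mean of the continuous function [P t h]; thus [P t h] is zero on the
    support. As [h] is positive outside the support, no mass escapes. *)
Lemma supp_absorbing T (P : R -> markovFeller X) t x :
  invariant_measure T P mu -> T t -> S x -> kernel_at (P t) x (~` S) = 0%E.
Proof.
move=> inv Tt Sx.
have [h [Ch h01 hS hSC]] := distance_function supp_closed Sx.
have Bh := Cb_Bb Ch.
have h0 : \int[mu]_y h y = 0.
  rewrite (mean_on mu1 mS muS)// -[RHS](_ : \int[mu]_(y in S) 0 = 0).
    by apply: eq_Rintegral => y /set_mem; exact: hS.
  by rewrite Rintegral_cst// mul0r.
have Uh : mf_fun (P t) h x = 0.
  apply: mean0_supp => //; first exact: mf_Cb.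
    by move=> y _; apply: mf_ge0 => // z; case/andP: (h01 z).
  by rewrite (mean_invariant inv).
have mSC : measurable (~` S : set (borel X)) by exact: measurableC.
pose g (n : nat) (y : X) : R := Num.min 1 (n%:R * h y).
have Cg n : Cb (g n).
  by apply: Cb_min; [exact: Cb_cst|apply: CbM => //; exact: Cb_cst].
have g01 n y : 0 <= g n y <= 1.
  rewrite /g ge_min lexx /= le_min ler01 mulr_ge0//.
  by case/andP: (h01 y).
have Ug n : mf_fun (P t) (g n) x = 0.
  apply/eqP; rewrite eq_le; apply/andP; split.
    rewrite -(mulr0 n%:R) -Uh -mfZ//.
    apply: le_mf => //; [exact: Cb_Bb|exact: BbZ|].
    by move=> y; rewrite /g ge_min lexx orbT.
  by apply: mf_ge0 => [|z]; [exact: Cb_Bb|case/andP: (g01 n z)].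
have : (fun n => mf_fun (P t) (g n) x) @ \oo --> mf_fun (P t) \1_(~` S) x.
  apply: (@mf_cvg _ _ _ _ _ 1) => //.
  - by move=> n; exact: Cb_Bb.
  - exact: Bb_indic.
  - by move=> n y; have /andP[? ?] := g01 n y; rewrite ger0_norm.
  - move=> y; rewrite indicE; have [nSy|Sy] := pselect ((~` S) y).
      rewrite mem_set//; apply/real_cvgP => e e0.
      exists (Num.truncn (h y)^-1).+1 => n nh.
      rewrite /g (_ : Num.min _ _ = 1) ?subrr ?normr0//.
      apply/min_idPl; rewrite -ler_pdivrMr ?hSC// mul1r.
      apply: ltW; apply: lt_le_trans (truncnS_gt _) _.
      by rewrite ler_nat.
    rewrite memNset// (_ : (fun n => _) = fun=> 0); first exact: cvg_cst.
    apply/funext => n; rewrite /g (hS _ (contrapT Sy)) mulr0.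
    by apply/min_idPr; exact: ler01.
rewrite (_ : (fun n => _) = fun=> 0); last by apply/funext => n; rewrite Ug.
move=> /(cvg_unique (@Rhausdorff R)) /(_ (cvg_cst _)).
rewrite mf_funE; last exact: Bb_indic.
rewrite /Rintegral integral_indic// setIT => H.
rewrite -[LHS]fineK ?H// ge0_fin_numE//.
rewrite (@le_lt_trans _ _ 1%E) ?ltry//.
rewrite -(kernel_at_mass (P t) x); apply: le_measure; rewrite ?inE//.
Qed.

End support.

(** * Times and eventual continuity *)
Section time_set.
Context {R : realType}.
Variable T : set R.
Hypothesis timeT : T = Nplus R \/ T = Rplus R.

Lemma time_nat n : T n.+1%:R.
Proof. by case: timeT => ->; [exists n|exact: ler0n]. Qed.

Lemma time_ge0 t : T t -> 0 <= t.
Proof. by case: timeT => -> //= [n _ <-]; exact: ler0n. Qed.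

Lemma time_add s t : T s -> T t -> T (s + t).
Proof.
case: timeT => ->; last exact: addr_ge0.
move=> [m _ <-] [n _ <-]; exists (m + n.+1)%N => //.
by rewrite -natrD addSn.
Qed.

Lemma time_sub s t : T s -> T t -> s < t -> T (t - s).
Proof.
case: timeT => ->; last by move=> _ _ /ltW; rewrite /Rplus/= subr_ge0.
move=> [m _ <-] [n _ <-]; rewrite ltr_nat ltnS => mn; exists (n - m).-1 => //.
by rewrite prednK ?subn_gt0// -natrB ?subSS// ltnW.
Qed.

Lemma time_large (n : nat) : exists2 t, T t & n%:R <= t.
Proof. by exists n.+1%:R; [exact: time_nat|rewrite ler_nat]. Qed.

End time_set.

(** The form in which eventual continuity is used. The time [N] depends on [x];
    this is what separates it from equicontinuity at late times. *)
Lemma eventually_continuousP {R : realType} {X : completeMetricType R}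
    (T : set R) (P : R -> markovFeller X) z f e :
  eventually_continuous_at T P z -> Lb f -> 0 < e ->
  exists2 d, 0 < d & forall x, mdist z x < d -> exists N : nat,
    forall t, T t -> N%:R <= t -> `|mf_fun (P t) f x - mf_fun (P t) f z| < e.
Proof.
move=> /[apply] ec e0; have : (limf_esup (fun x =>
      limf_esup (fun t => `|mf_fun (P t) f x - mf_fun (P t) f z|%:E)
        (within T (pinfty_nbhs R))) (nbhs z) < e%:E)%E by rewrite ec lte_fin.
rewrite {1}limf_esupE => /ereal_inf_lt[_ [V /nbhs_mdist[d d0 Vd] <-] supV].
exists d => // x /Vd Vx.
have : (limf_esup (fun t => `|mf_fun (P t) f x - mf_fun (P t) f z|%:E)
    (within T (pinfty_nbhs R)) < e%:E)%E.
  by apply: le_lt_trans supV; apply: ereal_sup_ubound; exists x.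
rewrite limf_esupE => /ereal_inf_lt[_ [W [M [Mr MW]] <-] supW].
exists (Num.truncn `|M|).+1 => t Tt Nt; rewrite -lte_fin.
apply: le_lt_trans supW; apply: ereal_sup_ubound; exists t => //.
apply: MW => //; apply: lt_le_trans Nt.
by apply: le_lt_trans (truncnS_gt _); exact: ler_norm.
Qed.

(** * Every point of the support reaches a given open set *)
Section recurrence.
Context {R : realType} {X : completeMetricType R}.
Variables (T : set R) (P : R -> markovFeller X) (mu : probability (borel X) R).
Hypotheses (sepX : separable X) (semiP : is_semigroup T P).
Hypothesis timeT : T = Nplus R \/ T = Rplus R.
Hypothesis ergmu : ergodic_measure T P mu.
Hypothesis ecP : forall z : X, eventually_continuous_at T P z.
Local Notation S := (supp mu).
Local Notation U t := (mf_fun (P t)).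

Let inv : invariant_measure T P mu := ergmu.1.
Let muS := supp_null mu sepX.
Let mS := @supp_borel _ _ mu.
Let mu1 : mu setT = 1%E := probability_setT mu.

(** Invariance of [mu] makes [U t g - g] a continuous function with mean zero;
    being nonnegative on the support it vanishes there. *)
Lemma subinvariant_eq t g : T t -> Cb g ->
  (forall x, S x -> g x <= U t g x) -> forall x, S x -> U t g x = g x.
Proof.
move=> Tt Cg gU x Sx; have CU : Cb (U t g) by exact: mf_Cb.
apply/eqP; rewrite -subr_eq0; apply/eqP.
apply: (mean0_supp (mu := mu) sepX (g := fun x => U t g x - g x)) => //.
  exact: CbB.
  by move=> y Sy; rewrite subr_ge0 gU.
rewrite (meanB mu1); [|exact: Cb_Bb|exact: Cb_Bb].
by rewrite (mean_invariant inv)// ?subrr//; exact: Cb_Bb.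
Qed.

Lemma superinvariant_eq t g : T t -> Cb g ->
  (forall x, S x -> U t g x <= g x) -> forall x, S x -> U t g x = g x.
Proof.
move=> Tt Cg gU x Sx; have Bg := Cb_Bb Cg.
have Ng y : U t (fun x => -1 * g x) y = - U t g y by rewrite mfZ// mulN1r.
have := @subinvariant_eq t (fun x => -1 * g x) Tt _ _ x Sx.
rewrite Ng mulN1r => H; apply: oppr_inj; apply: H.
  by apply: CbM => //; exact: Cb_cst.
by move=> y Sy; rewrite Ng mulN1r lerN2 gU.
Qed.

(** Ergodicity is about sets, so the invariance of [u] has to pass to
    [a < u]. The positive part [w] of [u - a] is subinvariant by Jensen, hence
    invariant; then [min 1 (n w)] is superinvariant, hence invariant, and these
    functions increase to the indicator of [a < u]. *)
Lemma level_set_dichotomy (u : X -> R) a : Cb u ->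
  (forall t x, T t -> S x -> U t u x = u x) ->
  mu [set x | a < u x] = 0%E \/ mu [set x | a < u x] = 1%E.
Proof.
move=> Cu uinv; set A := [set x | a < u x].
have mA : measurable (A : set (borel X)) by apply: superlevel_borel; case: Cu.
apply: ergmu.2 => // t Tt.
pose w (x : X) : R := Num.max 0 (u x - a).
have Cua : Cb (fun x => u x - a) by apply: CbB => //; exact: Cb_cst.
have Cw : Cb w by apply: Cb_max => //; exact: Cb_cst.
have Bw := Cb_Bb Cw.
have w0 x : 0 <= w x by rewrite /w le_max lexx.
have winv x : S x -> U t w x = w x.
  apply: subinvariant_eq => // {}x Sx.
  rewrite [leLHS]/w ge_max; apply/andP; split.
    exact: mf_ge0.
  rewrite -(uinv t x)// -(_ : U t (fun x => u x - a) x = U t u x - a).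
        apply: le_mf => //; first exact: Cb_Bb.
    by move=> y; rewrite /w le_max lexx orbT.
  by rewrite mfB ?mf_cst//; [exact: Cb_Bb|exact: Bb_cst].
pose v (n : nat) (x : X) : R := Num.min 1 (n%:R * w x).
have Cv n : Cb (v n).
  by apply: Cb_min; [exact: Cb_cst|apply: CbM => //; exact: Cb_cst].
have v01 n x : 0 <= v n x <= 1.
  by rewrite /v ge_min lexx /= le_min ler01 mulr_ge0.
have vinv n x : S x -> U t (v n) x = v n x.
  apply: superinvariant_eq => // {}x Sx.
  rewrite [leRHS]/v le_min; apply/andP; split.
    by apply: mf_le_cst => [|y]; [exact: Cb_Bb|case/andP: (v01 n y)].
  rewrite -(winv x Sx) -mfZ//; apply: le_mf; [exact: Cb_Bb|exact: BbZ|].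
  by move=> y; rewrite /v ge_min lexx orbT.
have vcvg x : v ^~ x @ \oo --> (\1_A x : R).
  rewrite indicE; have [Ax|nAx] := pselect (A x).
    rewrite mem_set//; apply/real_cvgP => e e0.
    have ax : 0 < u x - a by rewrite subr_gt0.
    exists (Num.truncn (u x - a)^-1).+1 => n nh.
    rewrite /v (_ : Num.min _ _ = 1) ?subrr ?normr0//.
    apply/min_idPl; have -> : w x = u x - a by apply/max_idPr/ltW.
    rewrite -ler_pdivrMr// mul1r.
    by apply: ltW; apply: lt_le_trans (truncnS_gt _) _; rewrite ler_nat.
  rewrite memNset// (_ : (fun n => _) = fun=> 0); first exact: cvg_cst.
  apply/funext => n; rewrite /v (_ : w x = 0).
    by rewrite mulr0; apply/min_idPr; exact: ler01.
  by apply/max_idPl; rewrite subr_le0 leNgt; exact/negP.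
have Ainv x : S x -> U t \1_A x = \1_A x.
  move=> Sx; apply: (cvg_unique (@Rhausdorff R) _ (vcvg x)).
  rewrite (_ : v ^~ x = (fun n => U t (v n) x)); last first.
    by apply/funext => n; rewrite vinv.
  apply: (@mf_cvg _ _ _ _ _ 1) => //.
  - by move=> n; exact: Cb_Bb.
  - exact: Bb_indic.
  - by move=> n y; have /andP[? ?] := v01 n y; rewrite ger0_norm.
exists (~` S); split => //; first exact: measurableC.
by move=> x /= nUA Sx; apply: nUA; exact: Ainv.
Qed.

(** Let [u x] be the upper limit of [U t phi x] as [t] goes to infinity.
    Eventual continuity makes [u] continuous, and the reverse Fatou lemma gives
    [u <= U t u], hence [u] is invariant on the support. Its mean is at least
    the mean [m] of [phi], which is positive because [phi] is positive at a
    point of the support; so the set [m / 2 < u] is not null and by ergodicity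
    has full measure. By continuity [u >= m / 2] on the support. *)
Lemma support_recurrent (phi : X -> R) y :
  Lb phi -> (forall x, 0 <= phi x <= 1) ->
  S y -> 0 < phi y ->
  exists2 c, 0 < c & forall x, S x -> exists2 t, T t & c < U t phi x.
Proof.
move=> Lphi phi01 Sy phiy.
have Cphi := Lb_Cb Lphi; have Bphi := Cb_Bb Cphi.
have Uphi01 t x : 0 <= U t phi x <= 1.
  apply/andP; split.
    by apply: mf_ge0 => // z; case/andP: (phi01 z).
  by apply: mf_le_cst => // z; case/andP: (phi01 z).
have UB t : Bb (U t phi) by exact: mf_Bb.
have /choice[u Hu] : forall x, exists l,
    (forall e, 0 < e ->
       exists N : nat, forall t, T t -> N%:R <= t -> U t phi x <= l + e) /\
    (forall e (N : nat), 0 < e ->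
       exists t, [/\ T t, N%:R <= t & l - e <= U t phi x]).
  move=> x; apply: (@limsup_of_bounded _ _ _ 1); last exact: time_large.
  by move=> t; have /andP[? ?] := Uphi01 t x; rewrite ger0_norm.
have u01 x : 0 <= u x <= 1.
  have [ub lb] := Hu x; apply/andP; split; apply/ler_addgt0Pr => e e0.
    have [N HN] := ub e e0; have [t Tt Nt] := time_large timeT N.
    by apply: le_trans (HN t Tt Nt); case/andP: (Uphi01 t x).
  have [t [_ _ H]] := lb e 0%N e0.
  by have /andP[_] := Uphi01 t x; lra.
have u_close x z e : 0 < e -> (exists N : nat, forall t, T t -> N%:R <= t ->
    `|U t phi x - U t phi z| < e) -> u x <= u z + 3 * e.
  move=> e0 [N HN]; have [ub _] := Hu z; have [_ lb] := Hu x.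
  have [N' HN'] := ub e e0; have [t [Tt Nt H]] := lb e (maxn N N') e0.
  have := HN' t Tt (le_trans _ Nt); have := HN t Tt (le_trans _ Nt).
  rewrite !ler_nat leq_maxl leq_maxr => /(_ isT) + /(_ isT).
  by rewrite ltr_norml => /andP[]; lra.
have cu : continuous u.
  apply/continuous_mdistP => z e e0.
  have e40 : 0 < e / 4 by rewrite divr_gt0.
  have [d d0 Hd] := eventually_continuousP (ecP z) Lphi e40.
  exists d => // x /Hd H.
  have H1 := u_close _ _ _ e40 H.
  have H2 : u z <= u x + 3 * (e / 4).
    apply: u_close => //.
    by have [N HN] := H; exists N => t Tt Nt; rewrite distrC HN.
  by rewrite ltr_norml; apply/andP; split; lra.
have Cu : Cb u.
  apply: (@Cb_of_bound _ _ 1) => // x.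
  by have /andP[? ?] := u01 x; rewrite ger0_norm.
have Bu := Cb_Bb Cu.
(* The excess over [u] tends to zero pointwise at late times, and dominated
   convergence for it replaces the reverse Fatou lemma. *)
pose g (t : R) (x : X) : R := Num.max 0 (U t phi x - u x).
have Bg t : Bb (g t) by apply: Bb_max; [exact: Bb_cst|exact: BbB].
have g1 t x : `|g t x| <= 1.
  rewrite ger0_norm ?le_max ?lexx// ge_max ler01/=.
  by have /andP[? ?] := Uphi01 t x; have /andP[? ?] := u01 x; lra.
have Uleg t x : U t phi x <= u x + g t x.
  by rewrite -lerBlDl le_max lexx orbT.
have gcvg (s : nat -> R) x : (forall n, T (s n)) -> (forall n, n%:R <= s n) ->
    (fun n => g (s n) x) @ \oo --> 0.
  move=> Ts sn; apply/real_cvgP => e e0; have [ub _] := Hu x.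
  have [N HN] := ub (e / 2) (divr_gt0 e0 (ltr0Sn _ 1)); exists N => n Nn.
  rewrite subr0 ger0_norm ?le_max ?lexx// gt_max e0/=.
  have := HN (s n) (Ts n) (le_trans _ (sn n)); rewrite ler_nat => /(_ Nn); lra.
have usub t x : T t -> u x <= U t u x.
  move=> Tt; apply/ler_addgt0Pr => e e0; have [_ lb] := Hu x.
  have e20 : 0 < e / 2 by rewrite divr_gt0.
  have /choice[s Hs] : forall n : nat, exists s,
      [/\ T s, n%:R <= s & u x - e / 2 <= U (s + t) phi x].
    move=> n; have [r [Tr nr Hr]] := lb (e / 2) (n + (Num.truncn t).+1)%N e20.
    have tt := truncnS_gt t.
    exists (r - t); split; last by rewrite subrK.
      apply: time_sub => //; apply: lt_le_trans nr; apply: lt_le_trans tt _.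
      by rewrite ler_nat leq_addl.
    by move: nr; rewrite natrD; lra.
  have H : (fun n => U t (g (s n)) x) @ \oo --> (0 : R).
    rewrite -[X in _ --> X](_ : U t (fun=> 0) x = 0); last by rewrite mf_cst.
    apply: (@mf_cvg _ _ _ _ _ 1) => //; first exact: Bb_cst.
    by move=> y'; apply: gcvg => n; case: (Hs n).
  have /real_cvgP/(_ _ e20)[N /(_ N (leqnn N))] := H.
  rewrite subr0 ltr_norml => /andP[_ HN].
  have [Ts _] := Hs N; rewrite (mf_semigroup semiP)// => Hx.
  have : U t (U (s N) phi) x <= U t (fun x => u x + g (s N) x) x.
    by apply: le_mf => //; exact: BbD.
  by rewrite mfD//; lra.
have uinv t x : T t -> S x -> U t u x = u x.
  by move=> Tt; apply: subinvariant_eq => // z _; exact: usub.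
pose m := \int[mu]_x phi x.
have m0 : 0 < m.
  rewrite lt_neqAle; apply/andP; split.
    apply/eqP => im; have := mean0_supp sepX Cphi _ (esym im) Sy => phi0.
    by move: phiy; rewrite phi0 ?ltxx// => z _; case/andP: (phi01 z).
  by apply: Rintegral_ge0 => z _; case/andP: (phi01 z).
have mu_u : m <= \int[mu]_x u x.
  apply/ler_addgt0Pr => e e0.
  have H : (fun n => \int[mu]_x g n.+1%:R x) @ \oo --> (0 : R).
    rewrite -[X in _ --> X](mean_cst mu1 0).
    apply: (@mean_cvg _ _ _ S _ _ _ _ _ 1) => //; first exact: Bb_cst.
    move=> x _; apply: (gcvg (fun n => n.+1%:R)) => n; first exact: time_nat.
    by rewrite ler_nat.
  have /real_cvgP/(_ _ e0)[N /(_ N (leqnn N))] := H.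
  rewrite subr0 ltr_norml => /andP[_ HN].
  rewrite /m -(mean_invariant inv (time_nat timeT N))//.
  apply: (@le_trans _ _ (\int[mu]_x (u x + g N.+1%:R x))).
    by apply: (le_mean mu1 mS muS) => //; exact: BbD.
  by rewrite (meanD mu1)//; lra.
pose a := m / 2; have a0 : 0 < a by rewrite divr_gt0.
pose A := [set x | a < u x].
have mA : measurable (A : set (borel X)) by exact: superlevel_borel.
have B1A := Bb_indic mA.
have muA : \int[mu]_x (\1_A x : R) = 1.
  rewrite mean_indic//; have [H|->//] := level_set_dichotomy a Cu uinv.
  have : \int[mu]_x u x <= \int[mu]_x (a + \1_A x).
    apply: (le_mean mu1 mS muS) => //; first by apply: BbD => //; exact: Bb_cst.
    move=> x _; rewrite indicE; have [Ax|nAx] := pselect (A x).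
      by rewrite mem_set//=; have /andP[_] := u01 x; lra.
    by rewrite memNset//= addr0 leNgt; exact/negP.
  rewrite (meanD mu1)//; last exact: Bb_cst.
  rewrite (mean_cst mu1) mean_indic//.
  by have -> : mu A = 0%E by []; rewrite /= addr0 /a; lra.
have ua x : S x -> a <= u x.
  move=> Sx; have : Num.max 0 (a - u x) = 0.
    apply: (mean0_supp (mu := mu) sepX
      (g := fun x => Num.max 0 (a - u x))) => //.
    - by apply: Cb_max; [exact: Cb_cst|apply: CbB => //; exact: Cb_cst].
    - by move=> z _; rewrite le_max lexx.
    apply/eqP; rewrite eq_le; apply/andP; split; last first.
      by apply: Rintegral_ge0 => z _; rewrite le_max lexx.
    rewrite -[leRHS](_ : \int[mu]_x (a * (1 - \1_A x)) = 0).
      apply: (le_mean mu1 mS muS) => //.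
      + by apply: Bb_max; [exact: Bb_cst|apply: BbB => //; exact: Bb_cst].
      + by apply: BbZ; apply: BbB => //; exact: Bb_cst.
      + move=> z _; rewrite indicE; have [Az|nAz] := pselect (A z).
          by rewrite mem_set// subrr mulr0 ge_max lexx subr_le0 ltW.
        rewrite memNset// subr0 mulr1 ge_max ltW//=.
        by have /andP[? _] := u01 z; lra.
    rewrite (meanZ mu1); last by apply: BbB => //; exact: Bb_cst.
    rewrite (meanB mu1)//; last exact: Bb_cst.
    by rewrite (mean_cst mu1) muA subrr mulr0.
  by move/max_idPl; rewrite subr_le0.
exists (a / 3); first by rewrite divr_gt0.
move=> x Sx; have [_ lb] := Hu x.
have [t [Tt _ H]] := lb (a / 3) 0%N (divr_gt0 a0 (ltr0Sn _ 2)).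
by exists t => //; have := ua x Sx; lra.
Qed.

End recurrence.

(** * Stopping the process where the dual orbit is almost constant *)
Section killing.
Context {R : realType} {X : completeMetricType R}.
Variables (T : set R) (P : R -> markovFeller X) (S : set X) (phi : X -> R).
Hypotheses (semiP : is_semigroup T P) (timeT : T = Nplus R \/ T = Rplus R).
Hypotheses (mS : measurable (S : set (borel X)))
  (absS : forall t x, T t -> S x -> kernel_at (P t) x (~` S) = 0%E).
Hypotheses (Cphi : Cb phi) (phi01 : forall x, 0 <= phi x <= 1).
Local Notation U t := (mf_fun (P t)).

(** The process runs for time [s] and is then stopped at its position [x] with
    probability [phi x]; [kill] averages [r] over the unstopped part. Iterating
    over a list of waiting times gives [kills]. *)
Definition kill (s : R) (r : X -> R) : X -> R :=
  U s (fun x => (1 - phi x) * r x).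

Definition kills (w : seq R) (r : X -> R) : X -> R := foldr kill r w.

Let Bphi : Bb phi := Cb_Bb Cphi.
Let C1phi : Cb (fun x => 1 - phi x).
Proof. by apply: CbB => //; exact: Cb_cst. Qed.
Let B1phi := Cb_Bb C1phi.
Let phi1 x : 0 <= 1 - phi x <= 1.
Proof. by have /andP[? ?] := phi01 x; apply/andP; split; lra. Qed.

Lemma kill_Cb s r : Cb r -> Cb (kill s r).
Proof. by move=> Cr; apply: mf_Cb; exact: CbM. Qed.

Lemma kill_Bb s r : Bb r -> Bb (kill s r).
Proof. by move=> Br; apply: mf_Bb; exact: BbM. Qed.

Lemma kill_norm s r x : Bb r -> (forall y, `|r y| <= 1) -> `|kill s r x| <= 1.
Proof.
move=> Br r1; apply: mf_norm_le => [|y]; first exact: BbM.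
by have /andP[? ?] := phi1 y; rewrite normrM mulr_ile1// ger0_norm.
Qed.

Lemma kill_ge0 s r x : Bb r -> (forall y, 0 <= r y) -> 0 <= kill s r x.
Proof.
move=> Br r0; apply: mf_ge0 => [|y]; first exact: BbM.
by have /andP[? ?] := phi1 y; rewrite mulr_ge0.
Qed.

Lemma le_kill s r1 r2 x : Bb r1 -> Bb r2 -> (forall y, r1 y <= r2 y) ->
  kill s r1 x <= kill s r2 x.
Proof.
move=> B1 B2 r12; apply: le_mf => [||y]; [exact: BbM|exact: BbM|].
by have /andP[? ?] := phi1 y; rewrite ler_wpM2l.
Qed.

Lemma kill_le s r x : Bb r -> (forall y, 0 <= r y) -> kill s r x <= U s r x.
Proof.
move=> Br r0; apply: le_mf => // [|y]; first exact: BbM.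
by have /andP[? ?] := phi1 y; rewrite ler_piMl.
Qed.

Lemma kill_linear s a f g : Bb f -> Bb g ->
  kill s (fun x => a * f x + g x) = (fun x => a * kill s f x + kill s g x).
Proof.
move=> Bf Bg; apply/funext => x; rewrite /kill -mfZ; last exact: BbM.
rewrite -mfD; [|by apply: BbZ; exact: BbM|exact: BbM].
by congr mf_fun; apply/funext => y; ring.
Qed.

Lemma kills_Cb w r : Cb r -> Cb (kills w r).
Proof. by move=> Cr; elim: w => //= s w IH; exact: kill_Cb. Qed.

Lemma kills_Bb w r : Bb r -> Bb (kills w r).
Proof. by move=> Br; elim: w => //= s w IH; exact: kill_Bb. Qed.

Lemma kills_ge0 w r x : Bb r -> (forall y, 0 <= r y) -> 0 <= kills w r x.
Proof.
move=> Br r0; elim: w x => //= s w IH x; apply: kill_ge0 => //.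
exact: kills_Bb.
Qed.

Lemma kills_norm w r x : Bb r -> (forall y, `|r y| <= 1) -> `|kills w r x| <= 1.
Proof.
move=> Br r1; elim: w x => //= s w IH x; apply: kill_norm => //.
exact: kills_Bb.
Qed.

Lemma le_kills w r1 r2 x : Bb r1 -> Bb r2 -> (forall y, r1 y <= r2 y) ->
  kills w r1 x <= kills w r2 x.
Proof.
move=> B1 B2 r12; elim: w x => //= s w IH x.
by apply: le_kill => //; exact: kills_Bb.
Qed.

Lemma kills_linear w a f g : Bb f -> Bb g ->
  kills w (fun x => a * f x + g x) = (fun x => a * kills w f x + kills w g x).
Proof.
move=> Bf Bg; elim: w => //= s w ->.
by rewrite kill_linear//; exact: kills_Bb.
Qed.

(** The probability of never having been stopped. *)
Definition survival w : X -> R := kills w (fun=> 1).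

Lemma survival_Cb w : Cb (survival w).
Proof. by apply: kills_Cb; exact: Cb_cst. Qed.

Lemma survival01 w x : 0 <= survival w x <= 1.
Proof.
apply/andP; split; first by apply: kills_ge0 => //; exact: Bb_cst.
apply: le_trans (ler_norm _) _.
by apply: kills_norm => [|y]; [exact: Bb_cst|rewrite normr1].
Qed.

(** With equidistant stopping times, surviving all of them includes surviving
    the one at time [k.+1 * d], where the process, had it not been stopped
    before, would be stopped with probability [U (k.+1 * d) phi x]. *)
Lemma survival_nseq d m k x : T d -> (k < m)%N ->
  survival (nseq m d) x <= 1 - U (k.+1%:R * d) phi x.
Proof.
move=> Td; elim: k m x => [|k IH] [//|m] x km;
  rewrite /survival/= -/(survival _).
  rewrite mul1r; apply: (@le_trans _ _ (U d (fun x => 1 - phi x) x)).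
    apply: le_mf => // [|y].
      by apply: BbM => //; exact: Cb_Bb (survival_Cb _).
    have /andP[? ?] := phi1 y; have /andP[? ?] := survival01 (nseq m d) y.
    by rewrite ler_piMr.
  by rewrite mfB ?mf_cst//; exact: Bb_cst.
have Td' : T (k.+1%:R * d).
  elim: (k) => [|j IHj]; first by rewrite mul1r.
  by rewrite -natr1 mulrDl mul1r; exact: time_add.
have Bs : Bb (survival (nseq m d)) by exact: Cb_Bb (survival_Cb _).
have BU : Bb (U (k.+1%:R * d) phi) by exact: mf_Bb.
apply: le_trans (kill_le _ _ Bs _) _.
  by move=> y; case/andP: (survival01 (nseq m d) y).
apply: (@le_trans _ _ (U d (fun x => 1 - U (k.+1%:R * d) phi x) x)).
  apply: le_mf => //; first by apply: BbB => //; exact: Bb_cst.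
  by move=> y; exact: IH.
rewrite mfB ?mf_cst//; last exact: Bb_cst.
by rewrite -(mf_semigroup semiP)// -[in leRHS]natr1 mulrDl mul1r.
Qed.

Lemma kill_cvg0 s (f_ : nat -> X -> R) x : T s -> S x ->
  (forall n, Bb (f_ n)) -> (forall n y, `|f_ n y| <= 1) ->
  (forall y, S y -> f_ ^~ y @ \oo --> (0 : R)) ->
  (fun n => kill s (f_ n) x) @ \oo --> (0 : R).
Proof.
move=> Ts Sx Bf f1 f0.
rewrite -[X in _ --> X](_ : U s (fun=> 0) x = 0); last by rewrite mf_cst.
apply: (@mf_cvg_on _ _ _ S _ _ _ _ _ 1) => //.
- exact: absS.
- by move=> n; exact: BbM.
- exact: Bb_cst.
- move=> n y; have /andP[? ?] := phi1 y.
  by rewrite normrM mulr_ile1// ger0_norm.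
- move=> y Sy; rewrite -[X in _ --> X](mulr0 (1 - phi y)).
  by apply: cvgM; [exact: cvg_cst|exact: f0].
Qed.

Lemma kills_cvg0 w (f_ : nat -> X -> R) x : (forall s, s \in w -> T s) -> S x ->
  (forall n, Bb (f_ n)) -> (forall n y, `|f_ n y| <= 1) ->
  (forall y, S y -> f_ ^~ y @ \oo --> (0 : R)) ->
  (fun n => kills w (f_ n) x) @ \oo --> (0 : R).
Proof.
move=> Tw Sx Bf f1 f0; elim: w Tw x Sx => [|s w IH] Tw x Sx /=; first exact: f0.
apply: kill_cvg0 => //.
- by apply: Tw; rewrite mem_head.
- by move=> n; exact: kills_Bb.
- by move=> n y; exact: kills_norm.
- by move=> y Sy; apply: IH => // r rw; apply: Tw; rewrite in_cons rw orbT.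
Qed.

(** If at every point of [S] one of the lists [W n] stops the process with
    probability at least [c], then appending a suitable [W n] to a list [w]
    multiplies its survival probability by about [1 - c]: the position reached
    after [w] is random, but by dominated convergence one [n] is good for most
    positions. Hence the infimum of the survival probabilities at [z] is at
    most [1 - c] times itself, that is, zero. *)
Lemma survival_small (W : nat -> seq R) (c : R) z (e : R) :
  0 < c -> S z -> 0 < e ->
  (forall n s, s \in W n -> T s) ->
  (forall x, S x ->
     exists N, forall n, (N <= n)%N -> survival (W n) x <= 1 - c) ->
  exists2 w, (forall s, s \in w -> T s) & survival w z < e.
Proof.
move=> c0 Sz e0 TW HW.
pose A := [set survival w z | w in [set w : seq R | forall s, s \in w -> T s]].
have A0 : A (survival [::] z) by exists [::].
have infA : has_inf A.
  split; first by exists (survival [::] z).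
  by exists 0 => _ [w _ <-]; case/andP: (survival01 w z).
have I0 : 0 <= inf A.
  apply: lb_le_inf; first by exists (survival [::] z).
  by move=> _ [w _ <-]; case/andP: (survival01 w z).
have c1 : c <= 1.
  have [N /(_ N (leqnn N))] := HW z Sz.
  by have /andP[? _] := survival01 (W N) z; lra.
have B1 : Bb (fun=> 1 : R) := Bb_cst 1.
have contract w h : (forall s, s \in w -> T s) -> 0 < h ->
    inf A <= (1 - c) * survival w z + h.
  move=> Tw h0.
  pose d (n : nat) (x : X) : R := Num.max 0 (survival (W n) x - (1 - c)).
  have Bs n : Bb (survival (W n)) by exact: Cb_Bb (survival_Cb _).
  have Bd n : Bb (d n).
    by apply: Bb_max; [exact: Bb_cst|apply: BbB => //; exact: Bb_cst].
  have d1 n y : `|d n y| <= 1.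
    rewrite ger0_norm ?le_max ?lexx// ge_max ler01/=.
    by have /andP[_ ?] := survival01 (W n) y; lra.
  have d0 y : S y -> d ^~ y @ \oo --> (0 : R).
    move=> Sy; apply/real_cvgP => h' h'0; have [N HN] := HW y Sy.
    exists N => n /HN Hn; rewrite /d (_ : Num.max _ _ = 0) ?subrr ?normr0//.
    by apply/max_idPl; rewrite subr_le0.
  have /real_cvgP/(_ h h0)[N /(_ N (leqnn N))] := kills_cvg0 Tw Sz Bd d1 d0.
  rewrite subr0 ltr_norml => /andP[_ HN].
  apply: (@le_trans _ _ (survival (w ++ W N) z)).
    apply: ge_inf; first exact: infA.2.
    exists (w ++ W N) => // s; rewrite mem_cat => /orP[|]; first exact: Tw.
    exact: TW.
  rewrite /survival /kills foldr_cat -/(kills _ _) -/(kills _ _) -/(survival _).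
  apply: (@le_trans _ _ (kills w (fun x => (1 - c) * 1 + d N x) z)).
    apply: le_kills => //; first by apply: BbD => //; exact: BbZ.
    by move=> y; rewrite mulr1 -lerBlDl /d le_max lexx orbT.
  by rewrite kills_linear// lerD2l ltW.
have I00 : inf A < e.
  rewrite ltNge; apply/negP => eI.
  have h0 : 0 < c * e / 4 by rewrite divr_gt0// mulr_gt0.
  have [_ [w Tw <-] Hw] := inf_adherent h0 infA.
  have := contract w _ Tw h0.
  have : c * e <= c * inf A by rewrite ler_pM2l.
  have : (1 - c) * survival w z <= (1 - c) * (inf A + c * e / 4).
    by apply: ler_wpM2l; [lra|exact: ltW].
  have : 0 <= c * (c * e / 4) by rewrite mulr_ge0// ltW.
  by lra.
have eI : 0 < e - inf A by rewrite subr_gt0.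
have [_ [w Tw <-] Hw] := inf_adherent eI infA.
by exists w => //; lra.
Qed.

(** In the application [phi] is a bump function in a ball on which the late
    orbit of [F] is almost constant, and [c t] is the value of [U t F] at one
    point. *)
Section spanning.
Variables (F : X -> R) (eps M : R) (c : R -> R) (N0 : nat).
Hypotheses (CF : Cb F) (eps0 : 0 < eps) (FM : forall x, `|F x| <= M).
Hypothesis cM : forall t, `|c t| <= M.
Hypothesis Fc : forall t x, T t -> N0%:R <= t -> S x -> 0 < phi x ->
  `|U t F x - c t| <= eps.

Let BF : Bb F := Cb_Bb CF.
Let M0 : 0 <= M := le_trans (normr_ge0 _) (FM point).

(** Up to [eps] and an error proportional to [r], all late elements of the
    orbit of [F] lie in a bounded part of the span of finitely many continuous
    functions. This is how equicontinuity is encoded: unlike equicontinuity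
    itself, it directly passes through the operators [U s]. *)
Definition spanned_up_to (r : X -> R) : Prop :=
  exists (N n : nat) (s : nat -> X -> R), (forall k, Cb (s k)) /\
    forall t, T t -> N%:R <= t ->
      exists2 a : nat -> R, (forall k, `|a k| <= M) &
      forall x, S x -> `|U t F x - \sum_(k < n) a k * s k x| <= eps + M * r x.

Lemma spanned_up_to1 : spanned_up_to (fun=> 1).
Proof.
exists 0%N, 0%N, (fun _ _ => 0); split=> [k|t Tt _]; first exact: Cb_cst.
exists (fun=> 0) => [k|x _]; first by rewrite normr0.
rewrite big_ord0 subr0 mulr1.
by apply: le_trans (mf_norm_le (c := M) _ _ BF FM) _; rewrite lerDr ltW.
Qed.

(** Write [U t F = U s0 (U (t - s0) F)] and split the inner function with
    weights [phi] and [1 - phi]. The first part is nearly [c (t - s0) * phi],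
    which contributes the single new function [U s0 phi]; the second part is
    treated by the hypothesis on [r]. *)
Lemma spanned_up_to_kill s0 r : T s0 -> Bb r -> spanned_up_to r ->
  spanned_up_to (kill s0 r).
Proof.
move=> Ts0 Br [N [n [s [Cs H]]]].
exists (N + N0 + (Num.truncn s0).+1)%N, n.+1,
  (fun k => if k is k'.+1 then kill s0 (s k') else U s0 phi).
split=> [[|k]|t Tt]; [exact: mf_Cb|exact: kill_Cb|rewrite !natrD => Nt].
have ts := truncnS_gt s0; have s00 := time_ge0 timeT Ts0.
have N0' : 0 <= N%:R :> R by exact: ler0n.
have N00' : 0 <= N0%:R :> R by exact: ler0n.
have Tt' : T (t - s0) by apply: time_sub => //; lra.
have [a aM Ha] := H (t - s0) Tt' ltac:(lra).
exists (fun k => if k is k'.+1 then a k' else c (t - s0)); first by case.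
move=> x Sx; rewrite big_ord_recl/=.
have Bs k : Bb (fun y => (1 - phi y) * s k y) by apply: BbM => //; exact: Cb_Bb.
have [Bsum Hsum] := mf_sum (P s0) n a x Bs.
rewrite -[in U t](subrK s0 t) (mf_semigroup semiP)//.
have BU : Bb (U (t - s0) F) by exact: mf_Bb.
pose G y := c (t - s0) * phi y + \sum_(k < n) a k * ((1 - phi y) * s k y).
have BG : Bb G by apply: BbD => //; exact: BbZ.
have -> : c (t - s0) * U s0 phi x + \sum_(i < n) a i * kill s0 (s i) x =
    U s0 G x.
  by rewrite mfD// ?mfZ// ?Hsum//; exact: BbZ.
rewrite -mfB//.
have -> : eps + M * kill s0 r x =
    U s0 (fun y => eps + M * ((1 - phi y) * r y)) x.
  rewrite mfD ?mf_cst ?mfZ//; [exact: BbM|exact: Bb_cst|].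
  by apply: BbZ; exact: BbM.
apply: (@mf_norm_le_on _ _ _ S) => //.
- exact: absS.
- exact: BbB.
- by apply: BbD; [exact: Bb_cst|apply: BbZ; exact: BbM].
move=> y Sy.
have -> : U (t - s0) F y - G y = phi y * (U (t - s0) F y - c (t - s0)) +
    (1 - phi y) * (U (t - s0) F y - \sum_(k < n) a k * s k y).
  have -> : G y = c (t - s0) * phi y + (1 - phi y) * \sum_(k < n) a k * s k y.
    by rewrite /G mulr_sumr; congr +%R; apply: eq_bigr => k _; ring.
  ring.
have /andP[p0 p1] := phi01 y.
apply: le_trans (ler_normD _ _) _; rewrite !normrM (ger0_norm p0).
rewrite (ger0_norm (_ : 0 <= 1 - phi y)) ?subr_ge0//.
have H1 : phi y * `|U (t - s0) F y - c (t - s0)| <= phi y * eps.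
  move: p0; rewrite le_eqVlt => /predU1P[<-|p0]; first by rewrite !mul0r.
  by apply: ler_wpM2l; [exact: ltW|apply: Fc => //; lra].
have H2 : (1 - phi y) * `|U (t - s0) F y - \sum_(k < n) a k * s k y| <=
    (1 - phi y) * (eps + M * r y).
  by apply: ler_wpM2l; [rewrite subr_ge0|exact: Ha].
have -> : eps + M * ((1 - phi y) * r y) =
    phi y * eps + (1 - phi y) * (eps + M * r y) by ring.
exact: lerD.
Qed.

Lemma spanned_up_to_survival w : (forall s, s \in w -> T s) ->
  spanned_up_to (survival w).
Proof.
elim: w => [_|s w IH Tw]; first exact: spanned_up_to1.
apply: spanned_up_to_kill.
- by apply: Tw; rewrite mem_head.
- exact: Cb_Bb (survival_Cb w).
- by apply: IH => r rw; apply: Tw; rewrite in_cons rw orbT.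
Qed.

Lemma spanned_equicontinuous r z : Cb r -> S z -> M * r z <= eps ->
  spanned_up_to r ->
  exists (N : nat) (d : R), 0 < d /\ forall x t, S x -> mdist z x < d -> T t ->
    N%:R <= t -> `|U t F x - U t F z| < 5 * eps.
Proof.
move=> Cr Sz rz [N [n [s [Cs H]]]].
pose q x := M * (r x - r z) + \sum_(k < n) M * `|s k x - s k z|.
have cq : q x @[x --> z] --> q z.
  apply: cvgD.
    apply: cvgM; first exact: cvg_cst.
    by apply: cvgB; [case: Cr => + _; exact|exact: cvg_cst].
  apply: cvg_big => [|k _]; first exact: add_continuous.
  apply: cvgM; first exact: cvg_cst.
  apply: cvg_norm; apply: cvgB; last exact: cvg_cst.
  by case: (Cs k) => + _; exact.
have qz : q z = 0.
  rewrite /q subrr mulr0 add0r big1// => k _.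
  by rewrite subrr normr0 mulr0.
have /cvgrPdistC_lt/(_ eps eps0)/nbhs_mdist[d d0 Hd] := cq.
exists N, d; split=> // x t Sx zx Tt Nt; have [a aM Ha] := H t Tt Nt.
have := Hd x zx; rewrite qz subr0 ltr_norml /q => /andP[_ qx].
have Hs : `|\sum_(k < n) a k * s k x - \sum_(k < n) a k * s k z| <=
    \sum_(k < n) M * `|s k x - s k z|.
  rewrite -sumrB; apply: le_trans (ler_norm_sum _ _ _) _.
  by apply: ler_sum => k _; rewrite -mulrBr normrM ler_wpM2r.
have Hx := Ha x Sx; have Hz := Ha z Sz.
move: Hs Hx Hz; rewrite !ler_norml ltr_norml.
move=> /andP[? ?] /andP[? ?] /andP[? ?].
by apply/andP; split; lra.
Qed.

End spanning.
End killing.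

(** * Replacing the time set by countably or finitely many times *)
Section time_discretization.
Context {R : realType} {X : completeMetricType R}.
Variables (T : set R) (P : R -> markovFeller X).
Hypothesis semiP : is_semigroup T P.
Hypothesis timeT : T = Nplus R \/ (T = Rplus R /\ strongly_continuous P).
Local Notation U t := (mf_fun (P t)).

Lemma time_disjunction : T = Nplus R \/ T = Rplus R.
Proof. by case: timeT => [|[]]; [left|right]. Qed.

(** Strong continuity is a limit along the right neighbourhoods of 0, which
    leave out 0 itself; there [U 0] is the identity. *)
Lemma strong_continuityP f (e : R) : T = Rplus R -> strongly_continuous P ->
  Cb f -> 0 < e ->
  exists2 h, 0 < h &
    forall s, 0 <= s -> s < h -> forall x, `|U s f x - f x| <= e.
Proof.
move=> TR sc Cf e0; have Bf := Cb_Bb Cf.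
have /cvgrPdistC_lt/(_ e e0) := sc f Cf; rewrite near_withinE => -[h /= h0 Hh].
exists h => // s; rewrite le_eqVlt => /predU1P[<- _ x|s0 sh x].
  rewrite (mf_semigroup0 semiP)// ?subrr ?normr0 ?ltW//.
  by rewrite TR /Rplus/=.
have := Hh s; rewrite /= sub0r normrN gtr0_norm// => /(_ sh s0).
rewrite subr0 => /ltW; apply: le_trans; apply: le_trans (ler_norm _).
rewrite /sup_norm; apply: ub_le_sup; last by exists x.
have [M M0 HM] : exists2 M, 0 <= M & forall x, `|U s f x - f x| <= M.
  by apply: Cb_bound; apply: CbB => //; exact: mf_Cb.
by exists M => _ [y _ <-].
Qed.

(** In continuous time a grid of mesh [n.+1^-1] contains a time shortly after
    [t], and right continuity suffices: [U (s + t) phi - U t phi] is the image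
    under [U t] of the uniformly small function [U s phi - phi]. *)
Lemma time_grid phi : Cb phi -> exists (d : nat -> R) (m : nat -> nat),
  (forall n, T (d n)) /\
  forall x t c, T t -> c < U t phi x -> exists N, forall n, (N <= n)%N ->
    exists2 k, (k < m n)%N & c <= U (k.+1%:R * d n) phi x.
Proof.
move=> Cphi; have Bphi := Cb_Bb Cphi; case: timeT => [TN|[TR sc]].
  exists (fun=> 1), id; split=> [n|x t c]; first by rewrite TN; exists 0%N.
  rewrite {1}TN => -[k _ <-] ck; exists k.+1 => n kn; exists k => //.
  by rewrite mulr1 ltW.
(* The [n]-th grid ends at time [n.+1], beyond any given [t] for large [n]. *)
exists (fun n => n.+1%:R^-1), (fun n => (n.+1 * n.+1)%N).
split=> [n|x t c Tt ct]; first by rewrite TR /Rplus/=.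
have t0 : 0 <= t by move: Tt; rewrite TR.
have g0 : 0 < U t phi x - c by rewrite subr_gt0.
have [h h0 Hh] := strong_continuityP TR sc Cphi g0.
exists (maxn (Num.truncn h^-1).+1 (Num.truncn t).+1) => n Nn.
have n0 : 0 < n.+1%:R :> R by rewrite ltr0n.
have hn : n.+1%:R^-1 < h.
  rewrite invf_plt ?posrE//; apply: lt_le_trans (truncnS_gt _) _.
  by rewrite ler_nat (leq_trans (leq_maxl _ _) (leqW Nn)).
have tn : t < n%:R.
  apply: lt_le_trans (truncnS_gt _) _.
  by rewrite ler_nat (leq_trans (leq_maxr _ _) Nn).
set k := Num.truncn (t * n.+1%:R).
have tn0 : 0 <= t * n.+1%:R by rewrite mulr_ge0// ltW.
have /andP[kt tk] : k%:R <= t * n.+1%:R < k.+1%:R by exact: truncn_itv.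
exists k.
  rewrite -(ltr_nat R); apply: le_lt_trans kt _; rewrite natrM ltr_pM2r//.
  by apply: lt_trans tn _; rewrite ltr_nat.
pose s := k.+1%:R / n.+1%:R - t.
have s0 : 0 <= s by rewrite subr_ge0 ler_pdivlMr// ltW.
have sh : s < h.
  apply: le_lt_trans hn; rewrite lerBlDr -natr1 mulrDl mul1r addrC lerD2l.
  by rewrite ler_pdivrMr.
have Ts : T s by rewrite TR.
rewrite (_ : _ / _ = s + t); last by rewrite subrK.
rewrite (mf_semigroup semiP)//.
have Bs : Bb (U s phi) by exact: mf_Bb.
have : `|U t (fun x => U s phi x - phi x) x| <= U t phi x - c.
  by apply: mf_norm_le => [|y]; [exact: BbB|exact: Hh].
by rewrite mfB// ler_norml => /andP[]; lra.
Qed.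

(** In continuous time the multiples of a small [h] form such a net, as
    [U t f - U (k * h) f] is the image of [U (t - k * h) f - f] under the
    contraction [U (k * h)]. *)
Lemma finite_time_net f (e : R) (N : nat) : Cb f -> 0 < e ->
  exists (tau : nat -> R) (n : nat), forall t, T t -> t <= N%:R ->
    exists2 k, (k < n)%N & forall x, `|U t f x - U (tau k) f x| <= e.
Proof.
move=> Cf e0; have Bf := Cb_Bb Cf; case: timeT => [TN|[TR sc]].
  exists (fun k => k.+1%:R), N => t; rewrite TN => -[k _ <-].
  by rewrite ler_nat => kN; exists k => // x; rewrite subrr normr0 ltW.
have [h h0 Hh] := strong_continuityP TR sc Cf e0.
exists (fun k => k%:R * h), (Num.truncn (N%:R / h)).+1 => t Tt tN.
have t0 : 0 <= t by move: Tt; rewrite TR.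
have th0 : 0 <= t / h by rewrite divr_ge0// ltW.
set k := Num.truncn (t / h).
have /andP[kt tk] : k%:R <= t / h < k.+1%:R by exact: truncn_itv.
exists k.
  by rewrite ltnS; apply: le_truncn; rewrite ler_pM2r ?invr_gt0.
move=> x; have kh : k%:R * h <= t by rewrite -ler_pdivlMr.
have s0 : 0 <= t - k%:R * h by rewrite subr_ge0.
have sh : t - k%:R * h < h.
  by rewrite ltrBlDr -[X in X + _]mul1r -mulrDl nat1r -ltr_pdivrMr.
have Tk : T (k%:R * h) by rewrite TR /Rplus/= mulr_ge0// ltW.
have Ts : T (t - k%:R * h) by rewrite TR.
rewrite -[X in U X f x - _](subrK (k%:R * h)) (mf_semigroup semiP)//.
have Bs : Bb (U (t - k%:R * h) f) by exact: mf_Bb.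
rewrite -mfB//; apply: mf_norm_le => [|y]; first exact: BbB.
exact: Hh.
Qed.

Lemma bounded_times_equicontinuous f z (e : R) (N : nat) : Cb f -> 0 < e ->
  exists2 d, 0 < d & forall x t, mdist z x < d -> T t -> t <= N%:R ->
    `|U t f x - U t f z| <= 3 * e.
Proof.
move=> Cf e0; have [tau [n H]] := finite_time_net N Cf e0.
have [d d0 Hd] : exists2 d, 0 < d & forall x k, mdist z x < d -> (k < n)%N ->
    `|U (tau k) f x - U (tau k) f z| < e.
  elim: {H} n => [|n [d d0 Hd]]; first by exists 1.
  have [/continuous_mdistP/(_ z e e0)[d' d'0 Hd'] _] := mf_Cb (P (tau n)) Cf.
  exists (Num.min d d'); first by rewrite lt_min d0.
  move=> x k; rewrite lt_min => /andP[xd xd'].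
  rewrite ltnS leq_eqVlt => /predU1P[->|kn]; first exact: Hd'.
  exact: Hd.
exists d => // x t zx Tt tN; have [k kn Hk] := H t Tt tN.
have := Hd x k zx kn; have := Hk x; have := Hk z.
rewrite ltr_norml !ler_norml => /andP[? ?] /andP[? ?] /andP[? ?].
by apply/andP; split; lra.
Qed.

End time_discretization.

(** * Equicontinuity on the support *)
Section equicontinuity_on_support.
Context {R : realType} {X : completeMetricType R}.
Variables (T : set R) (P : R -> markovFeller X) (mu : probability (borel X) R).
Hypotheses (sepX : separable X) (semiP : is_semigroup T P).
Hypothesis timeT : T = Nplus R \/ (T = Rplus R /\ strongly_continuous P).
Hypothesis ecP : forall z : X, eventually_continuous_at T P z.
Hypothesis ergmu : ergodic_measure T P mu.
Local Notation S := (supp mu).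
Local Notation U t := (mf_fun (P t)).

Let timeT' := time_disjunction timeT.

(** By eventual continuity at [z0] every point of the support near [z0] lies in
    one of the closed sets [A N] of points whose orbit stays [eps]-close to
    that of [z0] after time [N]; one of these sets contains a relative ball. *)
Lemma equicontinuous_ball F (eps : R) z0 : Lb F -> 0 < eps -> S z0 ->
  exists y r (N : nat), [/\ S y, 0 < r & forall t x, T t -> N%:R <= t -> S x ->
    mdist y x < r -> `|U t F x - U t F z0| <= eps].
Proof.
move=> LF e0 Sz0; have CF := Lb_Cb LF.
have [d d0 Hd] := eventually_continuousP (ecP z0) LF e0.
pose A (N : nat) := \bigcap_(t in [set t | T t /\ N%:R <= t])
  [set x | `|U t F x - U t F z0| <= eps].
have cA N : closed (A N).
  apply: closed_bigI => t [Tt Nt].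
  have cU : continuous (fun x => `|U t F x - U t F z0|).
    move=> x; apply: cvg_norm; apply: cvgB; last exact: cvg_cst.
    by case: (mf_Cb (P t) CF) => + _; exact.
  apply: (@closed_comp _ _ _ [set y | y <= eps]) => [x _|].
    exact: cU.
  exact: closed_le.
have cov x : S x -> mdist z0 x < d -> exists N, A N x.
  move=> _ /Hd[N HN]; exists N => t [Tt Nt] /=.
  by apply: ltW; exact: HN.
have [N [y [r [Sy r0 H]]]] := Baire_closed (@supp_closed _ _ mu) cA Sz0 d0 cov.
by exists y, r, N; split=> // t x Tt Nt Sx yx; apply: (H x Sx yx t).
Qed.

Lemma bump y (r : R) : 0 < r -> exists phi : X -> R,
  [/\ Lb phi, forall x, 0 <= phi x <= 1, 0 < phi y &
    forall x, 0 < phi x -> mdist y x < r].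
Proof.
move=> r0; pose phi (x : X) : R := Num.max 0 (1 - mdist y x / r).
have phi01 x : 0 <= phi x <= 1.
  rewrite /phi le_max lexx/= ge_max ler01/= gerBl divr_ge0// ?mdist_ge0//.
  exact: ltW.
have Llip x z : phi x - phi z <= r^-1 * mdist x z.
  rewrite lerBlDr /phi ge_max; apply/andP; split.
    apply: addr_ge0; last by case/andP: (phi01 z).
    by rewrite mulr_ge0 ?mdist_ge0 ?invr_ge0 ?ltW.
  apply: (@le_trans _ _ (r^-1 * mdist x z + (1 - mdist y z / r))); last first.
    by rewrite lerD2l le_max lexx orbT.
  have : r^-1 * mdist y z <= r^-1 * (mdist y x + mdist x z).
    by rewrite ler_wpM2l ?invr_ge0 ?(ltW r0)// metric_triangle.
  by rewrite mulrC; lra.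
exists phi; split=> //.
- split.
    exists r^-1 => x z; rewrite ler_norml Llip andbT.
    by have := Llip z x; rewrite metric_sym; lra.
  apply/bounded_funP; exists 1 => x; have /andP[? ?] := phi01 x.
  by rewrite ger0_norm.
- by rewrite /phi mdistxx mul0r subr0 lt_max ltr01 orbT.
- by move=> x; rewrite /phi lt_max ltxx/= subr_gt0 ltr_pdivrMr// mul1r.
Qed.

(** Stop the process in the ball of [equicontinuous_ball], where the orbit of
    [F] is almost constant, until from [z] it survives with probability of
    order [eps / M]: this settles the late times, and finitely many continuous
    functions settle the early ones. *)
Lemma equicontinuous_on_support F z (e : R) : Lb F -> S z -> 0 < e ->
  exists2 d, 0 < d & forall x t, S x -> mdist z x < d -> T t ->
    `|U t F x - U t F z| <= e.
Proof.
move=> LF Sz e0; have CF := Lb_Cb LF; have BF := Cb_Bb CF.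
pose eps := e / 5; have eps0 : 0 < eps by rewrite divr_gt0.
have [y [r [N0 [Sy r0 Hball]]]] := equicontinuous_ball LF eps0 Sz.
have [phi [Lphi phi01 phiy phir]] := bump y r0.
have Cphi := Lb_Cb Lphi.
have [c c0 Hc] :=
  support_recurrent sepX semiP timeT' ergmu ecP Lphi phi01 Sy phiy.
have mS := @supp_borel _ _ mu.
have absS t x : T t -> S x -> kernel_at (P t) x (~` S) = 0%E.
  by move=> Tt Sx; exact: (supp_absorbing sepX ergmu.1).
have [M M0 FM] := Cb_bound CF.
have [dn [mn [Tdn Hgrid]]] := time_grid semiP timeT Cphi.
have M10 : 0 < M + 1 by rewrite ltr_wpDl.
have epsM : 0 < eps / (M + 1) by rewrite divr_gt0.
have [w Tw wz] : exists2 w, (forall s, s \in w -> T s) &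
    survival P phi w z < eps / (M + 1).
  apply: (survival_small (S := S) (T := T)
    (W := fun n => nseq (mn n) (dn n)) mS absS Cphi phi01 c0 Sz epsM).
    by move=> n s; rewrite mem_nseq => /andP[_ /eqP ->].
  move=> x Sx; have [t Tt ct] := Hc x Sx.
  have [N HN] := Hgrid x t c Tt ct; exists N => n /HN[k kn ck].
  apply: le_trans (survival_nseq semiP timeT' Cphi phi01 x (Tdn n) kn) _.
  by rewrite lerD2l lerN2.
have [] := @spanned_equicontinuous _ _ T P S F eps M eps0 (survival P phi w) z.
- exact: survival_Cb.
- exact: Sz.
- apply: (@le_trans _ _ ((M + 1) * survival P phi w z)).
    by rewrite ler_wpM2r ?lerDl//; case/andP: (survival01 P Cphi phi01 w z).
  by rewrite mulrC -ler_pdivlMr// ltW.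
- apply: (@spanned_up_to_survival _ _ T P S phi semiP timeT' mS absS Cphi
    phi01 F eps M (fun t => U t F z) N0) => //.
  + by move=> t; exact: mf_norm_le.
  + by move=> t x Tt Nt Sx px; apply: Hball => //; exact: phir.
move=> N [d1 [d10 Hd1]].
have e3 : 0 < e / 3 by rewrite divr_gt0.
have [d2 d20 Hd2] := bounded_times_equicontinuous semiP timeT z N CF e3.
exists (Num.min d1 d2); first by rewrite lt_min d10.
move=> x t Sx; rewrite lt_min => /andP[xd1 xd2] Tt.
have [tN|/ltW Nt] := leP t N%:R.
  by apply: le_trans (Hd2 x t xd2 Tt tN) _; rewrite mulrC divfK.
by apply: ltW; apply: lt_le_trans (Hd1 x t Sx xd1 Tt Nt) _; rewrite mulrC divfK.
Qed.

Lemma restrict_funE t (f : S -> R) F (x : S) : T t -> Bb F ->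
  (forall y : S, F (val y) = f y) -> restrict_fun (P t) f x = U t F (val x).
Proof.
move=> Tt BF Ff; rewrite mf_funE// /restrict_fun.
rewrite (mean_on (kernel_at_mass (P t) (val x)) (@supp_borel _ _ mu))//;
  last first.
  by apply: (supp_absorbing sepX ergmu.1) => //; exact: set_valP.
apply: eq_Rintegral => y yS.
have := congr1 (fun g => g f (SigSub yS)) (@sigL_valL X R 0 S).
by rewrite /sigL /= => ->; rewrite -Ff.
Qed.

End equicontinuity_on_support.

Theorem corollary3p5 (R : realType) (X : completeMetricType R)
    (sepX : separable X) (T : set R) (P : R -> markovFeller X)
    (semiP : is_semigroup T P)
    (timeT : T = Nplus R \/ (T = Rplus R /\ strongly_continuous P))
    (ecP : forall z : X, eventually_continuous_at T P z)
    (mu : probability (borel X) R) (ergmu : ergodic_measure T P mu) :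
  e_property T (fun t => @restrict_fun R X (P t) (supp mu)).
Proof.
move=> z f Lf; have [F LF Ff] := McShane z Lf.
have T1 : T 1%:R by exact: (time_nat (time_disjunction timeT) 0).
apply/eqP; rewrite eq_le; apply/andP; split; last first.
  apply: limf_esup_ge0; first by move=> /nbhs_singleton.
  move=> x; apply: (@le_trans _ _
    (`|restrict_fun (P 1%:R) f x - restrict_fun (P 1%:R) f z|%:E)).
    by rewrite lee_fin.
  by apply: ereal_sup_ubound; exists 1%:R.
apply/lee_addgt0Pr => e e0; rewrite add0e limf_esupE.
have [d d0 Hd] :=
  equicontinuous_on_support sepX semiP timeT ecP ergmu LF (set_valP z) e0.
apply: (@le_trans _ _ (ereal_sup ((fun x => ereal_sup
    [set `|restrict_fun (P t) f x - restrict_fun (P t) f z|%:E | t in T]) @`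
    [set x | mdist z x < d]))).
  apply: ereal_inf_lbound; exists [set x | mdist z x < d] => //.
  by apply/nbhs_mdist; exists d.
apply: ge_ereal_sup => _ [x zx <-]; apply: ge_ereal_sup => _ [t Tt <-].
rewrite lee_fin !(restrict_funE sepX ergmu _ Tt (Cb_Bb (Lb_Cb LF)) Ff).
by apply: Hd => //; exact: set_valP.
Qed.
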